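(* Let $\phi\in\mathcal D_G$ be a sufficiently regular solution of $-\Delta\phi=g(\phi)$ in $\mathbb R^N$, where sufficiently regular means that the Pohozaev identity $\frac{N-2}{2}A(\phi)=N\mathcal B(\phi)$ holds. Put $A_\phi=A(\phi)$, $s_{\rm z}=a^{-1/2}$, \[ b_\phi(s)=\frac{1-as^2}{A_\phi^\theta}\,s^{\theta(N-2)-2},\qquad \Gamma_\phi=\bigl\{(b_\phi(s),\phi(s\,\cdot)):0<s\le s_{\rm z}\bigr\}, \] the exact spatial branch of solutions $(b,u)$ of \[ -\Bigl(a+b\Bigl(\int_{\mathbb R^N}|\nabla u|^2dx\Bigr)^\theta\Bigr)\Delta u=g(u)\quad\text{in }\mathbb R^N,\qquad b\ge0, \] generated by $\phi$. Then: (i) if $\theta(N-2)>2$, the branch $\Gamma_\phi$ has a unique nondegenerate turning bifurcation point $(b_\phi^*,\phi(s_*\cdot))$, where \[ s_*=\Bigl(\frac{\theta(N-2)-2}{a\theta(N-2)}\Bigr)^{1/2},\qquad b_\phi^*=\frac{2}{\theta(N-2)A_\phi^\theta}\Bigl(\frac{\theta(N-2)-2}{a\theta(N-2)}\Bigr)^{\frac{\theta(N-2)-2}{2}} . \] The branch contains exactly two points for each $0<b<b_\phi^*$, one point for $b=0$, one turning solution for $b=b_\phi^*$, and none for $b>b_\phi^*$; (ii) if $\theta(N-2)=2$, the branch contains exactly one point for each $0\le b<A_\phi^{-\theta}$, and none for $b\ge A_\phi^{-\theta}$; (iii) if $\theta(N-2)<2$, the branch contains exactly one point for every $b\ge0$.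 In particular, $\theta(N-2)>2$ is the sharp (necessary and sufficient) dimension–homogeneity condition for the occurrence of an interior turning bifurcation on an exact spatial branch, and this criterion is independent of the particular Berestycki–Lions nonlinearity $g$.
   Context: $N\ge3$, $a>0$, $\theta>0$. The function $g\in C(\mathbb R,\mathbb R)$ is odd and satisfies the Berestycki–Lions hypotheses: $-\infty<\liminf_{s\to0^+}g(s)/s\le\limsup_{s\to0^+}g(s)/s=-m<0$; $-\infty\le\limsup_{s\to+\infty}g(s)/s^{(N+2)/(N-2)}\le0$; and there is $\zeta>0$ with $G(\zeta)>0$, where $G(t)=\int_0^tg(\tau)\,d\tau$. Set $A(u)=\int_{\mathbb R^N}|\nabla u|^2dx$, $\mathcal B(u)=\int_{\mathbb R^N}G(u)\,dx$, and $\mathcal D_G=\{u\in H^1(\mathbb R^N)\setminus\{0\}:\mathcal B(u)\in\mathbb R\}$. Equations are understood in the weak (distributional) sense; $\phi(s\,\cdot)$ denotes the function $x\mapsto\phi(sx)$. A nondegenerate turning bifurcation point of a branch $s\mapsto(b(s),u(s))$ of solutions is a point $(b(s_* ),u(s_* ))$ with $b'(s_* )=0$, $b''(s_* )\neq0$, at which two branch solutions coalesce: for $b$ close to $b(s_* )$ on one side (below if $b''(s_* )<0$, above if $b''(s_* )>0$) there are two distinct solutions $u_\pm(b)$ on the branch at parameter value $b$, and $u_\pm(b)\to u(s_* )$ as $b\to b(s_* )$. It is interior if $0<s_*<s_{\rm z}$. *)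

(* Defs.v *)
From HB Require Import structures.
From mathcomp Require Import all_boot all_order all_algebra.
From mathcomp Require Import all_classical all_reals all_analysis.

Set Implicit Arguments.
Unset Strict Implicit.
Unset Printing Implicit Defensive.

Import Order.TTheory GRing.Theory Num.Theory.
Import numFieldNormedType.Exports.

Local Open Scope classical_set_scope.
Local Open Scope ring_scope.

(* Borel sigma-algebra of R^n, generated by the coordinate projections. *)
Section measurable_rV.
Context {R : realType} (n : nat).

Let coors : 'I_n -> 'rV[R]_n -> R := fun i x => x ord0 i.

Let rV_set0 : g_sigma_preimage coors set0.
Proof. exact: sigma_algebra0. Qed.

Let rV_setC A : g_sigma_preimage coors A -> g_sigma_preimage coors (~` A).
Proof. exact: sigma_algebraC. Qed.

Let rV_bigcup (F : _^nat) : (forall i, g_sigma_preimage coors (F i)) ->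
  g_sigma_preimage coors (\bigcup_i (F i)).
Proof. exact: sigma_algebra_bigcup. Qed.

HB.instance Definition _ := @isMeasurable.Build
  (measure_tuple_display default_measure_display) 'rV[R]_n
  (g_sigma_preimage coors) rV_set0 rV_setC rV_bigcup.

End measurable_rV.

Lemma measurable_rV_coord (R : realType) n (i : 'I_n) :
  measurable_fun setT (fun x : 'rV[R]_n => x ord0 i).
Proof.
move=> _ Y mY; rewrite setTI; apply: sub_sigma_algebra => /=.
rewrite -bigcup_seq/=; exists i => /=; first by rewrite mem_index_enum.
by exists Y => //; rewrite setTI.
Qed.

Lemma measurable_fun_rV d (T : measurableType d) (R : realType) n
    (f : T -> 'rV[R]_n) :
  (forall i, measurable_fun setT (fun t => f t ord0 i)) ->
  measurable_fun setT f.
Proof.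
move=> mf; have : <<s \big[setU/set0]_(i < n) preimage_set_system setT
    (fun x : 'rV[R]_n => x ord0 i) measurable >> `<=`
    [set A | measurable (f @^-1` A)].
  apply: smallest_sub.
    split => /=.
    - by rewrite preimage_set0; exact: measurable0.
    - by move=> A mA; rewrite setTD preimage_setC; exact: measurableC.
    - by move=> F mF; rewrite preimage_bigcup; exact: bigcup_measurable.
  rewrite -bigcup_seq => A [i _ [B mB <-]] /=.
  by rewrite setTI; have := mf i measurableT B mB; rewrite setTI.
by move=> sub _ A mA; rewrite setTI; exact: sub.
Qed.

Lemma sigma_finite_prod d1 d2 (T1 : measurableType d1) (T2 : measurableType d2)
    (R : realType) (m1 : {sigma_finite_measure set T1 -> \bar R})
    (m2 : {sigma_finite_measure set T2 -> \bar R}) :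
  sigma_finite setT (m1 \x m2)%E.
Proof.
have /sigma_finiteP[F [TF ndF Foo]] := sigma_finiteT m1.
have /sigma_finiteP[G [TG ndG Goo]] := sigma_finiteT m2.
exists (fun n => F n `*` G n).
  rewrite -setXTT TF TG predeqE => -[x y]; split.
    move=> [/= [n _ Fnx] [k _ Gky]]; exists (maxn n k) => //; split.
    - by move: x Fnx; exact/subsetPset/ndF/leq_maxl.
    - by move: y Gky; exact/subsetPset/ndG/leq_maxr.
  by move=> [n _ []/= ? ?]; split; exists n.
move=> k; have [? ?] := Foo k; have [? ?] := Goo k.
split; first exact: measurableX.
by rewrite product_measure1E// lte_mul_pinfty// ge0_fin_numE.
Qed.

(* Lebesgue measure on R^n, by induction on n: the unit mass at the only point
   of R^0, then the image of the product measure under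
   R * R^n -> R^(1 + n). *)
Section lebesgue_measure_rV.
Context {R : realType}.

Definition rV_cons n (p : R * 'rV[R]_n) : 'rV[R]_n.+1 :=
  row_mx (const_mx p.1 : 'rV[R]_1) p.2.

Definition rV_uncons n (x : 'rV[R]_n.+1) : R * 'rV[R]_n :=
  (x ord0 ord0, rsubmx (x : 'rV[R]_(1 + n))).

Lemma rV_consK n : cancel (@rV_cons n) (@rV_uncons n).
Proof.
move=> [x v]; rewrite /rV_uncons /rV_cons /= row_mxKr; congr pair.
rewrite (_ : ord0 = lshift n (ord0 : 'I_1)) ?ord1; last exact/val_inj.
by rewrite (row_mxEl (const_mx x : 'rV[R]_1) v) mxE.
Qed.

Lemma measurable_rV_cons n : measurable_fun setT (@rV_cons n).
Proof.
apply: measurable_fun_rV => i; rewrite /rV_cons.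
case: (split_ordP (m := 1) (n := n) i) => j ->.
  rewrite (_ : (fun t => _) = fst); first exact: measurable_fst.
  by apply/funext => t; rewrite (row_mxEl (const_mx t.1 : 'rV[R]_1) t.2) mxE.
rewrite (_ : (fun t => _) = (fun x : 'rV[R]_n => x ord0 j) \o snd).
  by apply: measurableT_comp measurable_snd; exact: measurable_rV_coord.
by apply/funext => t; exact: (row_mxEr (const_mx t.1 : 'rV[R]_1) t.2).
Qed.

Lemma measurable_rV_uncons n : measurable_fun setT (@rV_uncons n).
Proof.
apply/measurable_fun_pairP; split; first exact: measurable_rV_coord.
apply: measurable_fun_rV => i; rewrite /comp /=.
under eq_fun do rewrite mxE; exact: measurable_rV_coord.
Qed.

Section step.
Context n (mu : {sigma_finite_measure set 'rV[R]_n -> \bar R}).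

Definition lebesgue_rV_step : set 'rV[R]_n.+1 -> \bar R :=
  pushforward (lebesgue_measure \x mu)%E (@rV_cons n).

Let mcons := @measurable_rV_cons n.

Let step0 : lebesgue_rV_step set0 = 0%E.
Proof. exact: measure0. Qed.

Let step_ge0 A : (0 <= lebesgue_rV_step A)%E.
Proof. exact: measure_ge0. Qed.

Let step_sigma_additive : semi_sigma_additive lebesgue_rV_step.
Proof. exact: measure_semi_sigma_additive. Qed.

HB.instance Definition _ := isMeasure.Build _ _ _ lebesgue_rV_step
  step0 step_ge0 step_sigma_additive.

Let sigma_finite_step : sigma_finite setT lebesgue_rV_step.
Proof.
have [F FT mF] := sigma_finite_prod lebesgue_measure mu.
exists (fun k => @rV_uncons n @^-1` F k).
  by rewrite -preimage_bigcup -FT preimage_setT.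
move=> k; have [mFk Fk] := mF k; split.
  by rewrite -[X in measurable X]setTI; exact: measurable_rV_uncons.
rewrite /lebesgue_rV_step /pushforward -comp_preimage.
by rewrite (_ : _ \o _ = id) ?preimage_id//; apply/funext => p; exact: rV_consK.
Qed.

HB.instance Definition _ :=
  Measure_isSigmaFinite.Build _ _ _ lebesgue_rV_step sigma_finite_step.

End step.

Fixpoint lebesgue_rV n : {sigma_finite_measure set 'rV[R]_n -> \bar R} :=
  match n with
  | 0 => \d_(0 : 'rV[R]_0)
  | n'.+1 => lebesgue_rV_step (lebesgue_rV n')
  end.

End lebesgue_measure_rV.

Section sobolev.
Context {R : realType} {N : nat}.
Local Notation E := 'rV[R]_N.
Local Notation mu := (@lebesgue_rV R N).
Implicit Types (u : E -> R) (v : E -> E) (psi : E -> R).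

Definition partial (i : 'I_N) (f : E -> R) : E -> R :=
  fun x => 'D_(delta_mx ord0 i) f x.

Definition iter_partial (s : seq 'I_N) (f : E -> R) : E -> R :=
  foldr partial f s.

(* C_c^oo(R^N). *)
Definition test_function psi :=
  [/\ forall s, continuous (iter_partial s psi),
      forall s i x, derivable (iter_partial s psi) x (delta_mx ord0 i) &
      exists2 K : set E, compact K & forall x, ~ K x -> psi x = 0].

Definition weak_gradient u v :=
  (forall i, (fun x => v x ord0 i) \in Lfun mu 2%:E) /\
  (forall psi, test_function psi -> forall i,
    \int[mu]_x (u x * partial i psi x) = - \int[mu]_x (v x ord0 i * psi x)).

Definition H1 u := u \in Lfun mu 2%:E /\ exists v, weak_gradient u v.

(* A representative of the weak gradient, unique up to a null set. *)
Definition grad u : E -> E := xget (cst 0) (weak_gradient u).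

(* Euclidean inner product: the norm of 'rV[R]_N in the library is the sup norm. *)
Definition dotp (x y : E) : R := \sum_i x ord0 i * y ord0 i.

Definition dirichlet u : R := \int[mu]_x dotp (grad u x) (grad u x).

Definition H1_sqnorm u : R := dirichlet u + \int[mu]_x (u x) ^+ 2.

Definition primitive (g : R -> R) (t : R) : R :=
  if 0 <= t then \int[lebesgue_measure]_(s in `[0, t]) g s
  else - \int[lebesgue_measure]_(s in `[t, 0]) g s.

Definition potential (g : R -> R) u : R := \int[mu]_x primitive g (u x).

(* The integral of G(u) is a real number iff G(u) is Lebesgue integrable. *)
Definition DG (g : R -> R) u :=
  [/\ H1 u, ~ u = cst 0 %[ae mu] &
      mu.-integrable setT (EFin \o (primitive g \o u))].

(* - c \Delta u = g(u) in the sense of distributions. *)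
Definition weak_solution (c : R) (g : R -> R) u :=
  (forall K : set E, compact K -> mu.-integrable K (EFin \o (g \o u))) /\
  (forall psi, test_function psi ->
    c * \int[mu]_x dotp (grad u x) (\row_i partial i psi x) =
    \int[mu]_x (g (u x) * psi x)).

Definition kirchhoff_solution (a theta : R) (g : R -> R) (b : R) u :=
  [/\ 0 <= b, DG g u & weak_solution (a + b * dirichlet u `^ theta) g u].

Definition dilate (phi : E -> R) (s : R) : E -> R := fun x => phi (s *: x).

(* A branch of pairs (b, u). Elements of H^1 are classes of functions modulo
   almost everywhere equality, so points are counted modulo that relation. *)
Implicit Types (G : set (R * (E -> R))).

Definition no_point G (b : R) := forall u, ~ G (b, u).

Definition one_point G (b : R) :=
  exists2 u, G (b, u) & forall w, G (b, w) -> w = u %[ae mu].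

Definition two_points G (b : R) :=
  exists u1 u2, [/\ G (b, u1), G (b, u2), ~ u1 = u2 %[ae mu] &
    forall w, G (b, w) -> w = u1 %[ae mu] \/ w = u2 %[ae mu]].

Definition branch (I : set R) (b : R -> R) (U : R -> E -> R) :
  set (R * (E -> R)) := [set (b s, U s) | s in I].

(* Two distinct solutions of the branch at each parameter value beta near the
   limit of F, both tending to u in H^1 along F. *)
Definition coalesce G (F : set_system R) u :=
  exists up um : R -> E -> R,
  [/\ \forall beta \near F,
        [/\ G (beta, up beta), G (beta, um beta) &
            ~ up beta = um beta %[ae mu]],
      H1_sqnorm (fun x => up beta x - u x) @[beta --> F] --> 0 &
      H1_sqnorm (fun x => um beta x - u x) @[beta --> F] --> 0].

(* The points (b s, U s), s in I, where the branch has a nondegenerate turning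
   bifurcation. b is given on R, so that its derivatives at an endpoint of I are
   two-sided ones. *)
Definition turning_point (I : set R) (b : R -> R) (U : R -> E -> R) (s : R) :=
  [/\ I s,
      (\forall t \near s, derivable b t 1) /\ derive1 b s = 0,
      derivable (derive1 b) s 1 /\ derive1n 2 b s != 0,
      derive1n 2 b s < 0 -> coalesce (branch I b U) (b s)^'- (U s) &
      0 < derive1n 2 b s -> coalesce (branch I b U) (b s)^'+ (U s)].

End sobolev.

Definition berestycki_lions (R : realType) (N : nat) (m : R) (g : R -> R) :=
  [/\ continuous g,
      forall s, g (- s) = - g s,
      (-oo < limf_einf (fun s => (g s / s)%:E) 0^'+)%E /\
        limf_esup (fun s => (g s / s)%:E) 0^'+ = (- m)%:E,
      (limf_esup (fun s => (g s / s `^ ((N%:R + 2) / (N%:R - 2)))%:E) +oo%R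
        <= 0)%E &
      exists2 zeta, 0 < zeta & 0 < primitive g zeta].

Definition branch_parameter (R : realType) (N : nat) (a theta A s : R) : R :=
  (1 - a * s ^+ 2) / A `^ theta * s `^ (theta * (N%:R - 2) - 2).

(* Main.v *)
Require Import Defs.
From mathcomp Require Import finmap all_boot all_order all_algebra.
From mathcomp Require Import all_classical all_reals all_analysis.
From mathcomp Require Import measurable_realfun ring lra.

Set Implicit Arguments.
Unset Strict Implicit.
Unset Printing Implicit Defensive.

Import Order.TTheory GRing.Theory Num.Theory.
Import numFieldNormedType.Exports.

Local Open Scope classical_set_scope.
Local Open Scope ring_scope.

(** The dilate [u = phi (s .)] of a solution of [- Delta phi = g (phi)] has
    [int |grad u|^2 = s^(2 - N) A], and testing the equation of [phi] against
    [psi (s^-1 .)] shows that [u] solves [- c Delta u = g (u)] exactly when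
    [c s^2 = 1].  Inserting the Kirchhoff coefficient
    [c = a + beta (s^(2 - N) A)^theta] and solving for [beta] gives
    [beta = A^-theta (1 - a s^2) s^p] with [p = theta (N - 2) - 2]; this is
    [weak_solution_dilate] together with [kirchhoff_coefficient].  The diagram of
    the branch is therefore that of a function of the one variable [s] in
    ]0, a^(-1/2)], whose derivative has the sign of [p - (p + 2) a s^2].  If
    [p <= 0] the function is strictly decreasing, from +oo if [p < 0] and from
    [A^-theta] if [p = 0].  If [p > 0] it increases from 0 up to
    [a s^2 = p / (p + 2)] and then decreases to 0, with negative second
    derivative at the maximum.

    Three analytic facts turn this picture into statements about the branch.
    - [A > 0].  Otherwise the weak gradient of [phi] vanishes ([dirichlet_eq0]):
      the integral of [phi] against a bump then does not change when the bump
      moves along a coordinate axis ([bumps_translation]), while it tends to 0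
      when the bump goes to infinity because [phi] is square integrable.  Hence
      [phi] is orthogonal to all bumps, so it is zero, which is excluded.
    - Points with different [s] are different ([dilate_inj]), because the L^2
      norm of a nonzero function detects the dilation.
    - The two solutions near the fold converge in H^1 to the fold
      ([H1_sqnorm_dilate_cvg]), because dilation is continuous in L^2
      ([dilate_cvg]).

    The analysis rests on one density principle, [L2_closed_bumps]: a property
    of square integrable functions that is linear and stable under L^2 limits
    holds for all of them as soon as it holds for products of one-variable
    smooth bumps.  It gives the fundamental lemma of the calculus of variations,
    hence uniqueness of weak gradients, and the continuity of dilations. *)
(** * Affine changes of variables for Lebesgue measure on R^n *)

(** Lebesgue measure is determined by its values on half-open intervals, and the
    image of [s] times Lebesgue measure under the affine map has the same
    values. *)
Lemma ge0_integral_affine1 (R : realType) (s v : R) (f : R -> \bar R) :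
  0 < s -> measurable_fun [set: measurableTypeR R] f -> (forall x, 0 <= f x)%E ->
  (\int[lebesgue_measure]_x f (s * x + v)%R =
   s^-1%:E * \int[lebesgue_measure]_x f x)%E.
Proof.
move=> s0 mf f0.
pose h : measurableTypeR R -> measurableTypeR R := fun x => s * x + v.
have mh : measurable_fun [set: measurableTypeR R] h.
  by apply: measurable_funD => //; exact: measurable_funM.
have sV0 : 0 <= s^-1 by rewrite invr_ge0 ltW.
rewrite -[LHS]/(\int[lebesgue_measure]_(x in h @^-1` setT) (f \o h) x)%E.
rewrite -(ge0_integral_pushforward mh)//.
rewrite -[s^-1]/((NngNum sV0)%:num) -ge0_integral_mscale//.
apply: eq_measure_integral => //= A mA _.
have -> : pushforward lebesgue_measure h A =
   (s^-1%:E * (mscale (NngNum (ltW s0)) (pushforward lebesgue_measure h)) A)%E.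
  by rewrite /mscale/= muleA -EFinM mulVf ?gt_eqF// mul1e.
rewrite /mscale/=; congr (_ * _)%E.
rewrite -[LHS]/(pushforward (mscale (NngNum (ltW s0)) lebesgue_measure) h A).
apply/esym/lebesgue_measure_unique => //= _ [[a b]] _ <-.
rewrite /mscale /pushforward/=.
have -> : h @^-1` `]a, b] = `](a - v) / s, (b - v) / s]%classic.
  apply/seteqP; split => x /=; rewrite !in_itv/= /h ltr_pdivrMr// ler_pdivlMr//;
    by rewrite ltrBlDr lerBrDr mulrC.
rewrite !lebesgue_measure_itv/= !lte_fin ltr_pM2r ?invr_gt0// ltrD2r.
case: ifPn => _; last by rewrite mule0.
by rewrite -EFinM -mulrBl opprB addrA subrK mulrCA divff ?gt_eqF// mulr1.
Qed.

Lemma dilate_rV_cons (R : realType) n (s : R) (w : 'rV[R]_n.+1) (p : R * 'rV[R]_n) :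
  s *: rV_cons p + w =
  rV_cons (s * p.1 + w ord0 ord0, s *: p.2 + rsubmx (w : 'rV[R]_(1 + n))).
Proof.
apply/rowP => i; rewrite !mxE /rV_cons.
case: (split_ordP (m := 1) (n := n) i) => j ->.
  by rewrite /= !mxE /= !ord1; congr (_ + w _ _); exact/val_inj.
by rewrite /= !mxE.
Qed.

Lemma measurable_affine_rV (R : realType) n (s : R) (w : 'rV[R]_n) :
  measurable_fun setT (fun x : 'rV[R]_n => s *: x + w).
Proof.
apply: measurable_fun_rV => i.
under eq_fun do rewrite !mxE.
by apply: measurable_funD => //; apply: measurable_funM => //; exact: measurable_rV_coord.
Qed.

Lemma ge0_integral_rV_cons (R : realType) n (f : 'rV[R]_n.+1 -> \bar R) :
  measurable_fun setT f -> (forall x, 0 <= f x)%E ->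
  (\int[lebesgue_rV n.+1]_x f x =
   \int[lebesgue_measure]_x \int[lebesgue_rV n]_y f (rV_cons (x, y)))%E.
Proof.
move=> mf f0.
have mcons : measurable_fun [set: measurableTypeR R * 'rV[R]_n] (@rV_cons R n).
  exact: measurable_rV_cons.
have mfc : measurable_fun [set: measurableTypeR R * 'rV[R]_n] (f \o @rV_cons R n).
  exact: measurableT_comp mf mcons.
have -> : (\int[lebesgue_rV n.+1]_x f x =
    \int[lebesgue_measure \x lebesgue_rV n]_(x in rV_cons (n:=n) @^-1` setT) f (rV_cons x))%E.
  by rewrite -(ge0_integral_pushforward mcons).
by rewrite preimage_setT fubini_tonelli1//= => ?; exact: f0.
Qed.

(** Tonelli splits off the first coordinate, which contributes one factor
    [s^-1]; the remaining coordinates are the induction hypothesis. *)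
Lemma ge0_integral_affine (R : realType) n (s : R) (w : 'rV[R]_n)
    (f : 'rV[R]_n -> \bar R) :
  0 < s -> measurable_fun setT f -> (forall x, 0 <= f x)%E ->
  (\int[lebesgue_rV n]_x f (s *: x + w)%R =
   (s ^- n)%:E * \int[lebesgue_rV n]_x f x)%E.
Proof.
move=> s0; elim: n w f => [|n IH] w f mf f0.
  rewrite expr0 invr1 mul1e; apply: eq_integral => x _; congr f.
  by apply/rowP => -[].
have mf' : measurable_fun setT (fun x : 'rV[R]_n.+1 => f (s *: x + w)).
  exact: (measurableT_comp mf (measurable_affine_rV s w)).
have mcons : measurable_fun [set: measurableTypeR R * 'rV[R]_n] (@rV_cons R n).
  exact: measurable_rV_cons.
have mfc : measurable_fun [set: measurableTypeR R * 'rV[R]_n] (f \o @rV_cons R n).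
  exact: measurableT_comp mf mcons.
rewrite !ge0_integral_rV_cons//.
under eq_integral => x _.
  under eq_integral do rewrite dilate_rV_cons/=.
  rewrite (IH (rsubmx (w : 'rV_(1 + n))) (fun y => f (rV_cons (s * x + w ord0 ord0, y))))//; last first.
    exact: (measurableT_comp mfc (measurable_pair1 _)).
  over.
have mF : measurable_fun setT
  (fun x : measurableTypeR R => \int[lebesgue_rV n]_y f (rV_cons (x, y)))%E.
  apply: (measurable_fun_fubini_tonelli_F (m2 := lebesgue_rV n) (f \o @rV_cons R n)) => //= ?; exact: f0.
pose F x := (\int[lebesgue_rV n]_y f (rV_cons (x, y)))%E.
have F0 x : (0 <= F x)%E by exact: integral_ge0.
rewrite -[LHS]/(\int[lebesgue_measure]_x
  ((s ^- n)%:E * F (s * x + w ord0 ord0)%R))%E.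
rewrite (@ge0_integralZl _ (measurableTypeR R) _ _ _ measurableT
  (fun x => F (s * x + w ord0 ord0))); last 3 first.
- apply: (measurableT_comp mF).
  by apply: measurable_funD => //; exact: measurable_funM.
- by move=> x _; exact: F0.
- by rewrite lee_fin invr_ge0 exprn_ge0// ltW.
rewrite (@ge0_integral_affine1 R s (w ord0 ord0) F s0 mF F0) muleA -EFinM.
by rewrite exprS invfM mulrC.
Qed.

(** Distributivity holds even when both terms are infinite, so that the changes
    of variables below need measurability only. *)
Lemma gt0_muleBr (R : realType) (r : R) (x y : \bar R) : 0 < r ->
  (r%:E * (x - y) = r%:E * x - r%:E * y)%E.
Proof.
move=> r0; have rN : (0 < r%:E)%E by rewrite lte_fin.
case: x y => [x| |] [y| |] /=; rewrite ?(gt0_muley, gt0_muleNy)//.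
by rewrite -EFinM mulrBr.
Qed.

Lemma integral_affine (R : realType) n (s : R) (w : 'rV[R]_n)
    (f : 'rV[R]_n -> \bar R) :
  0 < s -> measurable_fun setT f ->
  (\int[lebesgue_rV n]_x f (s *: x + w)%R =
   (s ^- n)%:E * \int[lebesgue_rV n]_x f x)%E.
Proof.
move=> s0 mf; rewrite integralE [in RHS]integralE gt0_muleBr; last first.
  by rewrite invr_gt0 exprn_gt0.
rewrite -!(ge0_integral_affine w)//.
- by congr (_ - _)%E; apply: eq_integral => x _; rewrite !unlock.
- exact: measurable_funeneg.
- exact: measurable_funepos.
Qed.

Lemma integrable_affine (R : realType) n (s : R) (w : 'rV[R]_n)
    (f : 'rV[R]_n -> \bar R) :
  0 < s -> (lebesgue_rV n).-integrable setT f ->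
  (lebesgue_rV n).-integrable setT (fun x => f (s *: x + w)).
Proof.
move=> s0 /integrableP[mf foo]; apply/integrableP; split.
  exact: (measurableT_comp mf (measurable_affine_rV s w)).
rewrite (ge0_integral_affine w (f := fun x => `|f x|%E))//.
  by rewrite lte_mul_pinfty// ?lee_fin ?invr_ge0 ?exprn_ge0// ltW.
exact: measurableT_comp.
Qed.

Lemma Rintegral_affine (R : realType) n (s : R) (w : 'rV[R]_n)
    (f : 'rV[R]_n -> R) :
  0 < s -> measurable_fun setT f ->
  \int[lebesgue_rV n]_x f (s *: x + w) = s ^- n * \int[lebesgue_rV n]_x f x.
Proof.
move=> s0 mf; rewrite /Rintegral (integral_affine w (f := EFin \o f))//.
  case: (integral _ _ _) => [r| |]//=.
    by rewrite mulry gtr0_sg ?invr_gt0 ?exprn_gt0// mul1e mulr0.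
  by rewrite mulrNy gtr0_sg ?invr_gt0 ?exprn_gt0// mul1e mulr0.
exact/measurable_EFinP.
Qed.

Lemma measurable_ball_rV (R : realType) n (x : 'rV[R]_n) (e : R) :
  measurable (ball x e : set 'rV[R]_n).
Proof.
have [e0|e0] := ltP 0 e; last first.
  rewrite (_ : ball x e = set0) //; apply/seteqP; split => // y [].
  by rewrite ltNge e0.
rewrite (_ : ball x e = \bigcap_(i in [set: 'I_n])
   (fun y : 'rV[R]_n => y ord0 i) @^-1` ball (x ord0 i) e); last first.
  apply/seteqP; split => y.
    by move=> [_ h] i _; exact: h.
  by move=> h; split => // i j; rewrite !ord1; exact: h.
apply: fin_bigcap_measurable => // i _.
rewrite -[X in measurable X]setTI.
apply: measurable_rV_coord => //.
exact: measurable_ball.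
Qed.

(** The sigma-algebra is generated by the coordinates; an open set belongs to it
    because it is a countable union of balls with rational centre and radius
    [1 / (k + 1)]. *)
Lemma open_measurable_rV (R : realType) n (A : set 'rV[R]_n) :
  open A -> measurable A.
Proof.
move=> oA.
pose B (p : 'rV[rat]_n * nat) : set 'rV[R]_n :=
  ball (map_mx ratr p.1 : 'rV[R]_n) p.2.+1%:R^-1.
rewrite (_ : A = \bigcup_(p in [set p | B p `<=` A]) B p); last first.
  apply/seteqP; split => [x Ax|x [p pA /pA]//].
  have /nbhs_ballP[e e0 xeA] : nbhs x A by exact: open_nbhs_nbhs.
  have [k k2] : exists k : nat, k.+1%:R^-1 < e / 2 :> R.
    have e20 : 0 < e / 2 by rewrite divr_gt0.
    have [k _ /(_ k (leqnn k)) kP] := near_infty_natSinv_lt (PosNum e20).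
    by exists k.
  have h i : exists q : rat, ratr q \in `](x ord0 i - k.+1%:R^-1), (x ord0 i)[.
    by apply: rat_in_itvoo; rewrite ltrBlDr ltrDl.
  pose q := \row_i projT1 (cid (h i)).
  have xq : ball (map_mx ratr q : 'rV[R]_n) k.+1%:R^-1 x.
    split => // i j; rewrite !mxE (_ : i = ord0); last by rewrite ord1; exact/val_inj.
    case: (cid _) => r /=.
    rewrite in_itv/= => /andP[r1 r2].
    move: r1 r2; rewrite -ball_normE /= ltr_norml.
    move: (ratr r) (k.+1%:R^-1) (x ord0 j) => y1 y2 y3 h1 h2.
    by apply/andP; split; lra.
  exists (q, k) => //= y qy; apply: xeA.
  rewrite (splitr e); apply: (@ball_triangle _ _ (map_mx ratr q : 'rV[R]_n)).
    by apply: ball_sym; apply: le_ball xq; exact: ltW.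
  by apply: le_ball qy; exact: ltW.
rewrite bigcup_mkcond; apply: countable_bigcupT_measurable => [|p].
  exact: countableP.
by case: ifP => _; [exact: measurable_ball_rV|exact: measurable0].
Qed.

Lemma continuous_measurable_rV (R : realType) n (f : 'rV[R]_n -> R) :
  continuous f -> measurable_fun setT f.
Proof.
move=> /continuousP cf.
apply: (measurability _ (RGenOInfty.measurableE R)) => //.
move=> _ [_ [x ->] <-]; rewrite setTI; apply: open_measurable_rV.
by apply: cf; exact: interval_open.
Qed.

Lemma compact_measurable_rV (R : realType) n (K : set 'rV[R]_n) :
  compact K -> measurable K.
Proof.
move=> /(compact_closed (@norm_hausdorff R _)) cK.
have oC : open (~` K) by rewrite openC.
by rewrite -(setCK K); apply: measurableC; exact: open_measurable_rV.
Qed.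

(** * Square integrable functions and a density principle *)

Import HBNNSimple.

Section square_integrable.
Context d (T : measurableType d) (R : realType).
Variable mu : {measure set T -> \bar R}.
Implicit Types f g h : T -> R.
Local Notation L2 := (Lfun mu 2%:E).

Lemma integrable_EFinD f g :
  mu.-integrable setT (EFin \o f) -> mu.-integrable setT (EFin \o g) ->
  mu.-integrable setT (EFin \o (fun x => f x + g x)).
Proof. exact: integrableD. Qed.

Lemma integrable_EFinZ c f : mu.-integrable setT (EFin \o f) ->
  mu.-integrable setT (EFin \o (fun x => c * f x)).
Proof. exact: integrableZl. Qed.

Lemma Lfun2P f : f \in L2 <->
  measurable_fun setT f /\ mu.-integrable setT (EFin \o (fun x => f x ^+ 2)).
Proof.
split=> [fL|[mf if2]].
  by split; [move: fL => /sub_Lfun_mfun; rewrite inE|exact: Lfun2_integrable_sqr].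
rewrite inE; apply/andP; split; rewrite inE//= /finite_norm unlock /Lnorm.
rewrite poweR_lty//.
move/integrableP : if2 => [_]; congr (_ < _)%E; apply: eq_integral => x _ /=.
by rewrite ger0_norm ?sqr_ge0// powR_mulrn// -normrX ger0_norm ?sqr_ge0.
Qed.

Lemma Lfun2_measurable f : f \in L2 -> measurable_fun setT f.
Proof. by move=> /Lfun2P[]. Qed.

Lemma Lfun2_integrableM f g : f \in L2 -> g \in L2 ->
  mu.-integrable setT (EFin \o (fun x => f x * g x)).
Proof.
by move=> fL gL; have /Lfun1_integrable := Lfun2_mul_Lfun1 fL gL.
Qed.

Lemma Lfun2Z c f : f \in L2 -> (fun x => c * f x) \in L2.
Proof.
move=> /Lfun2P[mf if2]; apply/Lfun2P; split; first exact: measurable_funM.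
rewrite (_ : EFin \o _ = EFin \o (fun x => c ^+ 2 * f x ^+ 2)).
  exact: integrable_EFinZ.
by apply/funext => x /=; rewrite exprMn.
Qed.

Lemma Lfun2D f g : f \in L2 -> g \in L2 -> (fun x => f x + g x) \in L2.
Proof.
move=> fL gL; have [/Lfun2P[mf if2] /Lfun2P[mg ig2]] := (fL, gL).
apply/Lfun2P; split; first exact: measurable_funD.
have /(integrable_EFinZ 2) ifg := Lfun2_integrableM fL gL.
rewrite (_ : EFin \o _ =
  EFin \o (fun x => (f x ^+ 2 + g x ^+ 2) + 2 * (f x * g x))).
  by apply: integrable_EFinD ifg; exact: integrable_EFinD.
by apply/funext => x /=; congr EFin; ring.
Qed.

Lemma Lfun2N f : f \in L2 -> (fun x => - f x) \in L2.
Proof.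
move=> /(Lfun2Z (-1)).
by under eq_fun do rewrite mulN1r.
Qed.

Lemma Lfun2B f g : f \in L2 -> g \in L2 -> (fun x => f x - g x) \in L2.
Proof. by move=> fL gL; apply: Lfun2D => //; exact: Lfun2N. Qed.

Lemma Lfun2_le f g : measurable_fun setT f -> g \in L2 ->
  (forall x, `|f x| <= `|g x|) -> f \in L2.
Proof.
move=> mf /Lfun2P[mg ig2] fg; apply/Lfun2P; split => //.
apply: le_integrable ig2 => //; first exact/measurable_EFinP/measurable_funX.
by move=> x _ /=; rewrite lee_fin !normrX lerXn2r// nnegrE.
Qed.

Lemma indic_Lfun2 A : measurable A -> (mu A < +oo)%E -> (\1_A : T -> R) \in L2.
Proof.
move=> mA Aoo; apply/Lfun2P; split => //; apply/integrableP; split.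
  exact/measurable_EFinP/measurable_funX.
rewrite (eq_integral (fun x => (\1_A x)%:E))//= ?integral_indic ?setIT//.
by move=> x _ /=; rewrite indicE; case: (_ \in _); rewrite ?expr0n ?expr1n/= ?normr0 ?normr1.
Qed.

Lemma sqr_Rintegral_ge0 f : 0 <= \int[mu]_x (f x ^+ 2).
Proof. by apply: Rintegral_ge0 => x _; exact: sqr_ge0. Qed.

Lemma Rintegral_sqrDZ f g (t : R) : f \in L2 -> g \in L2 ->
  \int[mu]_x ((f x + t * g x) ^+ 2) =
  \int[mu]_x (f x ^+ 2) + t * 2 * \int[mu]_x (f x * g x)
  + t ^+ 2 * \int[mu]_x (g x ^+ 2).
Proof.
move=> fL gL; have [/Lfun2P[mf if2] /Lfun2P[mg ig2]] := (fL, gL).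
have ifg := Lfun2_integrableM fL gL.
rewrite -!RintegralZl// -!RintegralD//.
- by apply: eq_Rintegral => x _; ring.
- by apply: integrable_EFinD => //; exact: integrable_EFinZ.
- exact: integrable_EFinZ.
- exact: integrable_EFinZ.
Qed.

Lemma Rintegral_sqrD_le f g : f \in L2 -> g \in L2 ->
  \int[mu]_x ((f x + g x) ^+ 2) <=
  2 * \int[mu]_x (f x ^+ 2) + 2 * \int[mu]_x (g x ^+ 2).
Proof.
move=> fL gL; have := sqr_Rintegral_ge0 (fun x => f x + -1 * g x).
have := Rintegral_sqrDZ 1 fL gL; under eq_Rintegral do rewrite mul1r.
move=> ->; rewrite Rintegral_sqrDZ//; lra.
Qed.

(** The quadratic polynomial [t |-> int (f + t g)^2] is nonnegative, so that its
    discriminant is not positive. *)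
Lemma Rintegral_cauchy_schwarz f g : f \in L2 -> g \in L2 ->
  (\int[mu]_x (f x * g x)) ^+ 2 <=
  \int[mu]_x (f x ^+ 2) * \int[mu]_x (g x ^+ 2).
Proof.
move=> fL gL.
have q t : 0 <= \int[mu]_x (f x ^+ 2) + t * 2 * \int[mu]_x (f x * g x)
    + t ^+ 2 * \int[mu]_x (g x ^+ 2).
  by rewrite -Rintegral_sqrDZ//; exact: sqr_Rintegral_ge0.
have := sqr_Rintegral_ge0 g; have := sqr_Rintegral_ge0 f.
move: q; set a := \int[mu]_x (f x ^+ 2); set b := \int[mu]_x (f x * g x).
set c := \int[mu]_x (g x ^+ 2) => q a0.
rewrite le_eqVlt => /predU1P[c0|c0].
  rewrite -c0 mulr0; have [->|b0] := eqVneq b 0; first by rewrite expr0n.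
  (* If [int g^2 = 0] the polynomial is affine, and would be negative here. *)
  have := q (- (a + 1) / (2 * b)); rewrite -c0 mulr0 addr0.
  rewrite (_ : - (a + 1) / (2 * b) * 2 * b = - (a + 1)); last first.
    by field; rewrite b0.
  by rewrite opprD addrA subrr add0r oppr_ge0 ler10.
have := q (- b / c).
rewrite (_ : a + _ + _ = (a * c - b ^+ 2) / c); last by field; rewrite gt_eqF.
by rewrite ler_pdivlMr// mul0r subr_ge0.
Qed.

Lemma Lfun2_dominated_cvg (F : (T -> R)^nat) f g :
  (forall k, measurable_fun setT (F k)) -> measurable_fun setT f -> g \in L2 ->
  (forall x, F k x @[k --> \oo] --> f x) ->
  (forall k x, `|F k x - f x| <= g x) ->
  \int[mu]_x ((F k x - f x) ^+ 2) @[k --> \oo] --> (0 : R).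
Proof.
move=> mF mf /Lfun2P[mg ig2] Ff Fg.
have [] := @dominated_convergence _ _ _ mu setT measurableT
  (fun k x => ((F k x - f x) ^+ 2)%:E) (cst 0%E) (fun x => (g x ^+ 2)%:E).
- by move=> k; apply/measurable_EFinP/measurable_funX; exact: measurable_funB.
- exact: measurable_cst.
- apply: aeW => x _; apply/cvg_EFin; first exact: nearW.
  rewrite (_ : _ \o _ = fun k => (F k x - f x) ^+ 2)//.
  rewrite -[0%R](expr0n R 2); apply: (@cvg_comp _ _ _ _ (fun y : R => y ^+ 2)).
    by apply/subr_cvg0; exact: Ff.
  exact: exprn_continuous.
- exact: ig2.
- apply: aeW => x k _ /=; rewrite lee_fin normrX lerXn2r// ?nnegrE//.
  exact: le_trans (Fg k x).
move=> _ _; rewrite integral0 => h.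
exact: (fine_cvg h).
Qed.

(** Closed subspaces of L^2, as predicates: this is the form in which density is
    used below, as an induction principle on square integrable functions. *)
Definition L2_closed (P : set (T -> R)) :=
  [/\ forall f g, f \in L2 -> g \in L2 -> P f -> P g -> P (fun x => f x + g x),
      forall c f, f \in L2 -> P f -> P (fun x => c * f x) &
      forall (F : (T -> R)^nat) f, (forall k, F k \in L2) -> f \in L2 ->
        (forall k, P (F k)) ->
        \int[mu]_x ((F k x - f x) ^+ 2) @[k --> \oo] --> (0 : R) -> P f].

Lemma L2_closed_ext P f g : P f -> f =1 g -> P g :> Prop.
Proof. by move=> Pf /funext <-. Qed.

Lemma L2_closed_sum (P : set (T -> R)) n (F : 'I_n -> T -> R) : L2_closed P ->
  P (cst 0) -> cst 0 \in L2 ->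
  (forall i, F i \in L2) -> (forall i, P (F i)) ->
  (fun x => \sum_(i < n) F i x) \in L2 /\ P (fun x => \sum_(i < n) F i x).
Proof.
move=> [PD _ _] P0 L0 FL PF; elim: n F FL PF => [|n IH] F FL PF.
  by under eq_fun do rewrite big_ord0.
under eq_fun do rewrite big_ord_recl.
have [L1 P1] := IH (fun i => F (lift ord0 i)) (fun i => FL _) (fun i => PF _).
by split; [exact: Lfun2D|exact: PD].
Qed.

(** A closed subspace of L^2 that contains the indicators of a generating
    pi-system is everything: a Dynkin argument gives the indicators of all
    measurable sets localised to the exhausting sets [Q n], hence the localised
    simple functions, and these approximate any square integrable function. *)
Lemma L2_closed_density (P : set (T -> R)) (G : set (set T)) (Q : (set T)^nat) :
  L2_closed P ->
  @measurable _ T = <<s G >> -> setI_closed G ->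
  (forall n, G (Q n)) -> (forall n, (mu (Q n) < +oo)%E) ->
  (forall x, \forall n \near \oo, Q n x) ->
  (forall A, G A -> P (\1_A)) ->
  forall f, f \in L2 -> P f.
Proof.
move=> cP GE GI GQ Qoo Qx PG; have [PD PZ Plim] := cP.
have mG A : G A -> measurable A by move=> GA; rewrite GE; exact: sub_gen_smallest.
have mQ n : measurable (Q n) by exact: mG.
have LI A n : measurable A -> (\1_(A `&` Q n) : T -> R) \in L2.
  move=> mA; apply: indic_Lfun2; first exact: measurableI.
  apply: le_lt_trans (Qoo n); apply: le_measure; rewrite ?inE//.
  exact: measurableI.
have LQ n : (\1_(Q n) : T -> R) \in L2 by apply: indic_Lfun2.
have L0 : (cst 0 : T -> R) \in L2.
  by have := Lfun2Z 0 (LQ 0%N); under eq_fun do rewrite mul0r.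
have P0 : P (cst 0).
  by have := PZ 0 _ (LQ 0%N) (PG _ (GQ 0%N)); under eq_fun do rewrite mul0r.
have PI A : measurable A -> forall n, P (\1_(A `&` Q n)).
  move=> mA; have : <<s G >> A by rewrite -GE.
  move: A {mA}; apply: (dynkin_induction GE GI (P := fun A => forall n, P (\1_(A `&` Q n)))).
  - by move=> n; rewrite setTI; exact: PG.
  - by move=> A GA n; apply: PG; exact: GI.
  - move=> A mA PA n.
    have := PD _ _ (LQ n) (Lfun2Z (-1) (LI A n mA)) (PG _ (GQ n)) (PZ (-1) _ (LI A n mA) (PA n)).
    move/L2_closed_ext; apply => x.
    rewrite !indicE !in_setI in_setC.
    by case: (x \in A); case: (x \in Q n); rewrite /= ?mulr1 ?mulr0 ?subrr ?addr0.
  - move=> F mF tF PF n.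
    have part k : measurable (\big[setU/set0]_(i < k) F i) /\
        P (\1_((\big[setU/set0]_(i < k) F i) `&` Q n)).
      elim: k => [|k [mk Pk]].
        by rewrite big_ord0 set0I indic0; split.
      rewrite big_ord_recr/=; split; first exact: measurableU.
      have := PD _ _ (LI _ n mk) (LI _ n (mF k)) Pk (PF k n).
      move/L2_closed_ext; apply => x.
      rewrite !indicE !in_setI in_setU.
      case: (boolP (x \in F k)) => xk; last by rewrite orbF andFb addr0.
      rewrite (_ : (x \in \big[setU/set0]_(i < k) F i) = false) ?add0r//.
      apply/negbTE/negP; rewrite inE -bigcup_mkord => -[i /= ik Fi].
      move/trivIsetP : tF => /(_ i k Logic.I Logic.I (negbT (ltn_eqF ik))).
      by apply/eqP/set0P; exists x; split => //; rewrite inE in xk.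
    have mU : measurable (\bigcup_k F k) by exact: bigcupT_measurable.
    apply: (Plim (fun k => \1_((\big[setU/set0]_(i < k) F i) `&` Q n))).
    + by move=> k; apply: LI; have [] := part k.
    + exact: LI.
    + by move=> k; have [] := part k.
    apply: (Lfun2_dominated_cvg (g := \1_(Q n))) => //.
    + by move=> k; apply: measurable_indic; apply: measurableI => //; have [] := part k.
    + by apply: measurable_indic; exact: measurableI.
    + move=> x; have [[k _ Fkx]|nF] := pselect ((\bigcup_k F k) x).
        apply: cvg_near_cst; exists k.+1 => // j /= kj.
        rewrite !indicE !in_setI; congr (_ && _)%:R.
        rewrite !mem_set//; first by exists k.
        by rewrite -bigcup_mkord; exists k.
      apply: cvg_near_cst; exists 0%N => // j _.
      rewrite !indicE !in_setI; congr (_ && _)%:R.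
      rewrite !memNset// -bigcup_mkord => -[i _ Fi].
      by apply: nF; exists i.
    + move=> k x; rewrite !indicE !in_setI.
      have [xQ|xQ] := boolP (x \in Q n); last by rewrite !andbF subrr normr0.
      rewrite !andbT; case: (x \in _); case: (x \in _);
        by rewrite ?subrr ?normr0 ?subr0 ?sub0r ?normrN ?normr1.
have Pge0 f : f \in L2 -> (forall x, 0 <= f x) -> P f.
  move=> fL f0.
  have mf : measurable_fun setT (EFin \o f).
    by apply/measurable_EFinP; exact: Lfun2_measurable.
  pose F n := nnsfun_approx measurableT mf n.
  have Ff x : F n x @[n --> \oo] --> f x.
    have := @cvg_nnsfun_approx _ _ _ _ measurableT _ mf _ x Logic.I.
    by move=> /(_ (fun x _ => f0 x))/fine_cvg.
  have Fle n x : F n x <= f x.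
    have nd : nondecreasing_seq (fun n => F n x).
      by move=> i j ij; exact/lefP/nd_nnsfun_approx.
    have := nondecreasing_cvgn_le nd (cvgP _ (Ff x)) n.
    by rewrite (cvg_lim _ (Ff x)).
  have FQ n : (fun x => F n x * \1_(Q n) x) \in L2 /\ P (fun x => F n x * \1_(Q n) x).
    have := @L2_closed_sum P _ (fun (i : 'I_#|` fset_set (range (F n))|) x =>
      (fset_set (range (F n)))`_i *
      \1_(F n @^-1` [set (fset_set (range (F n)))`_i] `&` Q n) x) cP P0 L0.
    have mFn r : measurable (F n @^-1` [set r]) by exact: measurable_sfunP.
    have h1 (i : 'I_#|` fset_set (range (F n))|) : (fun x =>
      (fset_set (range (F n)))`_i *
      \1_(F n @^-1` [set (fset_set (range (F n)))`_i] `&` Q n) x) \in L2.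
      by apply: Lfun2Z; exact: LI.
    move=> /(_ h1) [|L1 P1].
      by move=> i; apply: PZ; [exact: LI|exact: PI].
    suff -> : (fun x => F n x * \1_(Q n) x) = fun x =>
      \sum_(i < #|` fset_set (range (F n))|) (fset_set (range (F n)))`_i *
      \1_(F n @^-1` [set (fset_set (range (F n)))`_i] `&` Q n) x by [].
    apply/funext => x; rewrite {1}(fimfunEord (F n) x) mulr_suml.
    by apply: eq_bigr => i _; rewrite indicI -mulrA.
  apply: (Plim (fun n x => F n x * \1_(Q n) x)) => //.
  - by move=> k; have [] := FQ k.
  - by move=> k; have [] := FQ k.
  apply: (Lfun2_dominated_cvg (g := f)) => //.
  - by move=> k; apply: Lfun2_measurable; have [] := FQ k.
  - exact: Lfun2_measurable.
  - move=> x; rewrite -[f x]mulr1; apply: cvgM => //.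
    apply: cvg_near_cst; have := Qx x; apply: filterS => n Qn.
    by rewrite indicE mem_set.
  - move=> k x; have := Fle k x; have : 0 <= F k x by [].
    rewrite indicE; case: (x \in Q k); rewrite ?mulr1 ?mulr0 => h1 h2.
      by rewrite ler0_norm ?subr_le0// opprB gerBl.
    by rewrite sub0r normrN ger0_norm.
move=> f fL; have mf := Lfun2_measurable fL.
have Lp : (fun x => Num.max (f x) 0) \in L2.
  apply: (Lfun2_le _ fL); first exact: measurable_maxr.
  move=> x; have [f0|f0] := leP (f x) 0; first by rewrite normr0.
  by [].
have Ln : (fun x => Num.max (- f x) 0) \in L2.
  apply: (Lfun2_le _ fL).
    by apply: measurable_maxr => //; exact: measurableT_comp.
  move=> x; have [f0|f0] := leP (- f x) 0; first by rewrite normr0.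
  by rewrite normrN.
have Pp := Pge0 _ Lp (fun x => ltac:(by rewrite le_max lexx orbT)).
have Pn := Pge0 _ Ln (fun x => ltac:(by rewrite le_max lexx orbT)).
apply: (L2_closed_ext (PD _ _ Lp (Lfun2Z (-1) Ln) Pp (PZ (-1) _ Ln Pn))) => x.
by have [f0|f0] := leP (f x) 0; have [g0|g0] := leP (- f x) 0; lra.
Qed.

End square_integrable.

Section square_integrable_theory.
Context d (T : measurableType d) (R : realType).
Variable mu : {measure set T -> \bar R}.
Implicit Types f g h : T -> R.
Local Notation L2 := (Lfun mu 2%:E).

Lemma Rintegral_sqr_eq0 f : f \in L2 -> \int[mu]_x (f x ^+ 2) = 0 ->
  f = cst 0 %[ae mu].
Proof.
move=> /Lfun2P[mf if2] f0.
have mf2 : measurable_fun setT (fun x => (f x ^+ 2)%:E).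
  by apply/measurable_EFinP; exact: measurable_funX.
have : (\int[mu]_x `|(f x ^+ 2)%:E| = 0)%E.
  under eq_integral do rewrite gee0_abs ?lee_fin ?sqr_ge0//.
  by rewrite -[LHS]fineK ?integrable_fin_num// -/(Rintegral _ _ _) f0.
move/(ae_eq_integral_abs mu measurableT mf2); apply: filterS => x /= /(_ Logic.I).
by move=> /eqP; rewrite eqe sqrf_eq0 => /eqP.
Qed.

Lemma eq_Rintegral_sqr f g : f \in L2 -> g \in L2 -> f = g %[ae mu] ->
  \int[mu]_x (f x ^+ 2) = \int[mu]_x (g x ^+ 2).
Proof.
move=> /Lfun2P[mf _] /Lfun2P[mg _] fg; congr fine.
apply: ae_eq_integral => //; [|exact/measurable_EFinP/measurable_funX..|].
  exact/measurable_EFinP/measurable_funX.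
by apply: filterS fg => x fgx _; rewrite /= fgx.
Qed.

(** Orthogonality passes to L^2 limits, by the Cauchy-Schwarz inequality. *)
Lemma cvg_Rintegral_orthogonal (F : (T -> R)^nat) f g : f \in L2 -> g \in L2 ->
  (forall k, F k \in L2) -> (forall k, \int[mu]_x (f x * F k x) = 0) ->
  \int[mu]_x ((F k x - g x) ^+ 2) @[k --> \oo] --> (0 : R) ->
  \int[mu]_x (f x * g x) = 0.
Proof.
move=> fL gL FL fF Fg; apply/eqP; rewrite -sqrf_eq0 eq_le sqr_ge0 andbT.
have Fg' : \int[mu]_x (f x ^+ 2) * \int[mu]_x ((F k x - g x) ^+ 2)
    @[k --> \oo] --> (0 : R).
  rewrite -[X in _ --> X](mulr0 (\int[mu]_x (f x ^+ 2))).
  by apply: cvgM Fg; exact: cvg_cst.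
apply: (ler_cvg_to (cvg_cst _) Fg'); apply: nearW => k /=.
apply: le_trans (Rintegral_cauchy_schwarz fL (Lfun2B (FL k) gL)).
under [X in _ <= X ^+ 2]eq_Rintegral do rewrite mulrBr.
by rewrite RintegralB ?fF ?sub0r ?sqrrN//; exact: Lfun2_integrableM.
Qed.

End square_integrable_theory.

(** * Smooth functions of one variable and smooth bumps *)

Section smooth1.
Context {R : realType}.
Implicit Types f g : R -> R.

(** Recursion on the order of differentiability makes stability under products a
    plain induction, since the product rule lowers the order of one factor. *)
Fixpoint Ck n f : Prop := (forall x, derivable f x 1) /\
  if n is n'.+1 then Ck n' (derive1 f) else True.

Definition smooth f := forall n, Ck n f.

Lemma Ck_derivable n f x : Ck n f -> derivable f x 1.
Proof. by case: n => [|n] []. Qed.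

Lemma CkW n f : Ck n.+1 f -> Ck n f.
Proof.
elim: n f => [|n IH] f; first by case.
by move=> [df Cf]; split => //; exact: IH.
Qed.

Lemma smooth_derivable f x : smooth f -> derivable f x 1.
Proof. by move=> /(_ 0%N)/Ck_derivable. Qed.

Lemma smooth_derive f : smooth f -> smooth (derive1 f).
Proof. by move=> sf n; have [] := sf n.+1. Qed.

Lemma smooth_continuous f : smooth f -> continuous f.
Proof.
by move=> sf x; apply: differentiable_continuous; apply/derivable1_diffP;
  exact: smooth_derivable.
Qed.

Lemma CkD n f g : Ck n f -> Ck n g -> Ck n (fun x => f x + g x).
Proof.
elim: n f g => [|n IH] f g Cf Cg;
  have df x : derivable f x 1 := Ck_derivable Cf; have dg x : derivable g x 1 := Ck_derivable Cg.
  by split => // x; exact: (derivableD (df x) (dg x)).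
split=> [x|]; first exact: (derivableD (df x) (dg x)).
rewrite (_ : derive1 _ = fun x => derive1 f x + derive1 g x); last first.
  by apply/funext => x; rewrite !derive1E deriveD.
by apply: IH; [case: Cf|case: Cg].
Qed.

Lemma CkZ n c f : Ck n f -> Ck n (fun x => c * f x).
Proof.
elim: n f => [|n IH] f Cf; have df x : derivable f x 1 := Ck_derivable Cf.
  by split => // x; exact: derivableZ.
split=> [x|]; first exact: derivableZ.
rewrite (_ : derive1 _ = fun x => c * derive1 f x); last first.
  by apply/funext => x; rewrite !derive1E deriveZ.
by apply: IH; case: Cf.
Qed.

Lemma CkM n f g : Ck n f -> Ck n g -> Ck n (fun x => f x * g x).
Proof.
elim: n f g => [|n IH] f g Cf Cg;
  have df x : derivable f x 1 := Ck_derivable Cf; have dg x : derivable g x 1 := Ck_derivable Cg.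
  by split => // x; exact: (derivableM (df x) (dg x)).
split=> [x|]; first exact: (derivableM (df x) (dg x)).
rewrite (_ : derive1 _ = fun x => f x * derive1 g x + g x * derive1 f x); last first.
  by apply/funext => x; rewrite !derive1E deriveM.
apply: CkD; apply: IH; [exact: CkW|by case: Cg|exact: CkW|by case: Cf].
Qed.

Lemma is_derive_affine f (c d x : R) : derivable f (c * x + d) 1 ->
  is_derive x 1 (fun y => f (c * y + d)) (c * derive1 f (c * x + d)).
Proof.
move=> df; have hf : is_derive (c * x + d) 1 f (derive1 f (c * x + d)).
  by apply: DeriveDef => //; rewrite derive1E.
have ha : is_derive x 1 (fun y => c * y + d) c.
  by apply: is_derive_eq; rewrite addr0 /GRing.scale/= mulr1.
have := @is_derive1_comp _ f (fun y => c * y + d) x _ _ hf ha.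
by rewrite mulrC.
Qed.

Lemma Ck_affine n f c d : Ck n f -> Ck n (fun x => f (c * x + d)).
Proof.
elim: n f => [|n IH] f Cf.
  split => // x; have [] // := @is_derive_affine f c d x _.
  exact: Ck_derivable Cf.
have df x : derivable f x 1 by exact: Ck_derivable Cf.
split=> [x|]; first by have [] := is_derive_affine (df (c * x + d)).
rewrite (_ : derive1 _ = fun x => c * derive1 f (c * x + d)); last first.
  apply/funext => x; have hf := is_derive_affine (df (c * x + d)).
  by rewrite derive1E derive_val.
by apply: CkZ; apply: IH; case: Cf.
Qed.

(** The functions x^-n exp(-1/x) extended by 0 are closed, up to linear
    combinations, under differentiation; this is what makes exp(-1/x) smooth
    at the origin. *)
Definition flat n (x : R) : R := if 0 < x then x ^- n * expR (- x^-1) else 0.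

Lemma flat_ge0 n x : 0 <= flat n x.
Proof.
rewrite /flat; case: ifPn => // x0.
by rewrite mulr_ge0 ?expR_ge0// invr_ge0 exprn_ge0// ltW.
Qed.

(** From [exp y >= y^(n + 1) / (n + 1)!] at [y = 1 / x]. *)
Lemma flat_le n x : 0 < x -> flat n x <= n.+1`!%:R * x.
Proof.
move=> x0; rewrite /flat x0 -exprVn expRN.
have := expR_ge1Dxn n (ltW (_ : 0 < x^-1)); rewrite invr_gt0 => /(_ x0).
set y := x^-1 => h.
have y0 : 0 < y by rewrite invr_gt0.
rewrite ler_pdivrMr ?expR_gt0// -[x]invrK -/y mulrAC ler_pdivlMr// -exprSr.
rewrite -ler_pdivrMl ?ltr0n ?fact_gt0// mulrC.
by apply: le_trans h; rewrite lerDr.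
Qed.

(** At the origin the difference quotient of [flat n] is [flat n.+1], which
    [flat_le] bounds by a multiple of the increment. *)
Lemma is_derive_flat n (x : R) :
  is_derive x 1 (flat n) (flat n.+2 x - n%:R * flat n.+1 x).
Proof.
have [x0|x0|->] := ltrgt0P x.
- have xN0 : x != 0 by rewrite gt_eqF.
  have h : is_derive x 1 (expR \o (fun y : R => - n%:R * ln y - y^-1))
      (flat n.+2 x - n%:R * flat n.+1 x).
    have hV : is_derive x 1 (fun y : R => y^-1) (- x ^- 2).
      by have := @is_deriveV _ id x 1 1 xN0; rewrite /GRing.scale/= mulr1; apply.
    have hL : is_derive x 1 (fun y : R => - n%:R * ln y - y^-1)
        (- n%:R * x^-1 - - x ^- 2).
      by apply: is_deriveB; apply: is_deriveZ; exact: is_derive1_ln.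
    apply: is_derive_eq (is_derive1_comp _ hL) _.
    rewrite /flat x0 expRD mulNr expRN expRM_natl lnK ?posrE//.
    by rewrite -!exprVn !exprS; ring.
  apply: (near_eq_is_derive _ h).
  near=> y; have y0 : 0 < y by near: y; exact: lt_nbhsr.
  by rewrite /flat y0 /= expRD mulNr expRN expRM_natl lnK ?posrE.
- rewrite /flat (lt_gtF x0) mulr0 subr0.
  apply: (near_eq_is_derive (f := cst 0)) => //.
  by near=> y; rewrite ifF//; apply/negbTE; rewrite -leNgt ltW//; near: y; exact: lt_nbhsl.
- rewrite {2 3}/flat ltxx mulr0 subr0.
  have h : (fun h : R => h^-1 *: (flat n (h *: 1 + 0) - flat n 0)) @ 0^' --> (0 : R).
    apply/cvgrPdist_le => e e0; near=> h.
    rewrite sub0r normrN /flat ltxx subr0 addr0 /GRing.scale/= mulr1.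
    have [h0|h0] := ltP 0 h; last by rewrite mulr0 normr0 ltW.
    have := flat_le n.+1 h0; rewrite /flat h0 => fl.
    rewrite mulrA -invfM -exprS.
    rewrite ger0_norm; last first.
      by rewrite mulr_ge0// ?expR_ge0// invr_ge0 exprn_ge0// ltW.
    apply: (le_trans fl).
    rewrite -ler_pdivlMl ?ltr0n ?fact_gt0// mulrC.
    rewrite -(ger0_norm (ltW h0)); near: h.
    by apply: dnbhs0_le; rewrite divr_gt0 ?ltr0n ?fact_gt0.
  by apply: DeriveDef; [exact: (cvgP _ h)|exact: (cvg_lim _ h)].
Unshelve. all: by end_near. Qed.

Lemma Ck_flat k n : Ck k (flat n).
Proof.
elim: k n => [|k IH] n.
  by split => // x; have [] := is_derive_flat n x.
split=> [x|]; first by have [] := is_derive_flat n x.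
rewrite (_ : derive1 _ = fun x => flat n.+2 x + (- n%:R) * flat n.+1 x).
  by apply: CkD => //; exact: CkZ.
apply/funext => x; have h := is_derive_flat n x.
by rewrite derive1E derive_val mulNr.
Qed.

(** [bump a b k] is supported in ]a, b[, takes its values in [0, 1], and tends
    to the indicator of ]a, b[ as k grows. *)
Definition bump (a b : R) (k : nat) (x : R) : R :=
  flat 0 (k.+1%:R * x - k.+1%:R * a) * flat 0 (- k.+1%:R * x + k.+1%:R * b).

Lemma smooth_bump a b k : smooth (bump a b k).
Proof.
move=> n; apply: CkM; last exact: Ck_affine (Ck_flat n 0).
exact: (Ck_affine _ (- (k.+1%:R * a)) (Ck_flat n 0)).
Qed.

Lemma flat0_le1 x : flat 0 x <= 1.
Proof.
rewrite /flat; case: ifPn => // x0.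
by rewrite expr0 invr1 mul1r -[leRHS]expR0 ler_expR oppr_le0 invr_ge0 ltW.
Qed.

Lemma bump_ge0 a b k x : 0 <= bump a b k x.
Proof. by rewrite mulr_ge0// flat_ge0. Qed.

Lemma bump_le1 a b k x : bump a b k x <= 1.
Proof. by rewrite mulr_ile1// ?flat_ge0// flat0_le1. Qed.

Lemma bump_out a b k x : ~~ (a < x < b) -> bump a b k x = 0.
Proof.
rewrite negb_and -!leNgt /bump /flat => /orP[xa|bx].
  by rewrite ltNge -mulrBr pmulr_rle0 ?ltr0n// subr_le0 xa mul0r.
rewrite [X in _ * X]ifF ?mulr0// mulNr addrC -mulrBr pmulr_rgt0 ?ltr0n//.
by rewrite subr_gt0 ltNge bx.
Qed.

Lemma bump_cvg a b x : bump a b k x @[k --> \oo] --> (((a < x < b)%R : bool)%:R : R).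
Proof.
have fl c : 0 < c -> flat 0 (k.+1%:R * c) @[k --> \oo] --> (1 : R).
  move=> c0; rewrite -[X in _ --> X](@expR0 R).
  under eq_fun => k.
    rewrite /flat pmulr_rgt0 ?ltr0n// c0 expr0 invr1 mul1r invfM -mulrN.
    over.
  apply: (@cvg_comp _ _ _ _ expR _ (nbhs (0 : R))); last exact: continuous_expR.
  have : k.+1%:R^-1 * - c^-1 @[k --> \oo] --> 0 * - c^-1.
    by apply: cvgM; [exact: cvg_harmonic|exact: cvg_cst].
  by rewrite mul0r.
have [/andP[ax xb]|axb] := boolP (a < x < b); last first.
  by apply: cvg_near_cst; apply: nearW => k; rewrite bump_out.
rewrite /bump; under eq_fun => k.
  rewrite -mulrBr mulNr [X in _ * flat 0 X]addrC -[X in _ * flat 0 X]mulrBr; over.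
rewrite -subr_gt0 in ax; rewrite -subr_gt0 in xb.
have h := cvgM (fl _ ax) (fl _ xb); rewrite mulr1 in h. exact: h.
Qed.

End smooth1.

(** * Tensor products of smooth functions are test functions *)

Section tensor.
Context {R : realType} {N : nat}.
Local Notation E := 'rV[R]_N.
Local Notation mu := (@lebesgue_rV R N).
Implicit Types (eta : 'I_N -> R -> R).

Definition tensor eta (x : E) : R := \prod_i eta i (x ord0 i).

(** Along a coordinate axis a tensor product is a function of one variable times
    a constant, which reduces partial derivatives to ordinary ones. *)
Lemma tensor_direction eta i (x : E) (h : R) :
  tensor eta (h *: delta_mx ord0 i + x) =
  eta i (h + x ord0 i) * \prod_(j | j != i) eta j (x ord0 j).
Proof.
rewrite /tensor (bigD1 i)//= !mxE !eqxx/= mulr1; congr (_ * _).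
by apply: eq_bigr => j ji; rewrite !mxE (negbTE ji) andbF mulr0 add0r.
Qed.

Lemma is_derive_tensor eta i (x : E) : derivable (eta i) (x ord0 i) 1 ->
  is_derive x (delta_mx ord0 i) (tensor eta)
    (tensor (fun j => if j == i then derive1 (eta i) else eta j) x).
Proof.
move=> de; set C := \prod_(j | j != i) eta j (x ord0 j).
have tE : tensor (fun j => if j == i then derive1 (eta i) else eta j) x =
    derive1 (eta i) (x ord0 i) * C.
  rewrite /tensor (bigD1 i)//= eqxx; congr (_ * _).
  by apply: eq_bigr => j /negbTE ->.
have h : h^-1 *: ((tensor eta \o shift x) (h *: delta_mx ord0 i) - tensor eta x)
   @[h --> 0^'] --> (derive1 (eta i) (x ord0 i) * C : R).
  have -> : (fun h : R => h^-1 *: ((tensor eta \o shift x) (h *: delta_mx ord0 i) - tensor eta x))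
     = fun h => (h^-1 *: (eta i (h + x ord0 i) - eta i (x ord0 i))) * C.
    apply/funext => h /=; rewrite tensor_direction -/C.
    rewrite [tensor eta x](bigD1 i)//= -/C /GRing.scale/=; ring.
  apply: cvgM; last exact: cvg_cst.
  rewrite derive1E; move: de => /cvg_ex[l /= hl].
  rewrite /derive (cvg_lim _ hl)//.
  by under eq_fun => h do rewrite -[h in eta i (h + _)]mulr1.
by rewrite tE; apply: DeriveDef; [exact: (cvgP _ h)|exact: (cvg_lim _ h)].
Qed.

Lemma partial_tensor eta i : (forall j, smooth (eta j)) ->
  partial i (tensor eta) =
  tensor (fun j => if j == i then derive1 (eta i) else eta j).
Proof.
move=> se; apply/funext => x; rewrite /partial.
have h := is_derive_tensor (smooth_derivable (x := x ord0 i) (se i)).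
exact: derive_val.
Qed.

Lemma coord_continuous i : continuous (fun x : E => x ord0 i).
Proof.
move=> x A /nbhs_ballP[e e0 xeA]; apply/nbhs_ballP; exists e => //= y [_ xy].
by apply: xeA; exact: xy.
Qed.

Lemma cvg_tensor (T : Type) (F : set_system T) {FF : Filter F}
    (f : T -> 'I_N -> R) (l : 'I_N -> R) :
  (forall i, f t i @[t --> F] --> l i) ->
  \prod_i f t i @[t --> F] --> \prod_i l i.
Proof.
move=> fl; elim: (index_enum _) => [|i r IH].
  by under eq_fun do rewrite big_nil; rewrite big_nil; exact: cvg_cst.
under eq_fun do rewrite big_cons; rewrite big_cons.
by apply: cvgM; [exact: fl|exact: IH].
Qed.

Lemma continuous_tensor eta : (forall j, continuous (eta j)) ->
  continuous (tensor eta).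
Proof.
move=> ce x.
apply: (@cvg_tensor _ (nbhs x) _ (fun y i => eta i (y ord0 i))
  (fun i => eta i (x ord0 i))) => i.
apply: (@continuous_comp _ _ _ (fun x : E => x ord0 i)); last exact: ce.
exact: coord_continuous.
Qed.

(** All the iterated partial derivatives of a tensor product are of the same
    form, so that smoothness need only be known in one variable. *)
Lemma iter_partial_tensor eta s : (forall j, smooth (eta j)) ->
  exists2 eta', (forall j, smooth (eta' j)) &
    iter_partial s (tensor eta) = tensor eta'.
Proof.
move=> se; elim: s => [|i s [eta' se' eq']]; first by exists eta.
exists (fun j => if j == i then derive1 (eta' i) else eta' j).
  by move=> j; case: ifP => // _; exact: smooth_derive.
by rewrite /= -partial_tensor// -eq'.
Qed.

Lemma test_function_tensor eta (a b : 'I_N -> R) : (forall j, smooth (eta j)) ->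
  (forall i x, ~~ (a i < x < b i) -> eta i x = 0) ->
  test_function (tensor eta).
Proof.
move=> se out; split.
- move=> s; have [eta' se' ->] := iter_partial_tensor s se.
  by apply: continuous_tensor => j; exact: smooth_continuous.
- move=> s i x; have [eta' se' ->] := iter_partial_tensor s se.
  have h := is_derive_tensor (smooth_derivable (x := x ord0 i) (se' i)).
  by case: h.
- exists [set x : E | forall i, `[a i, b i]%classic (x ord0 i)].
    apply: (@rV_compact R N (fun i => `[a i, b i]%classic)) => i.
    exact: segment_compact.
  move=> x /existsNP[i xi]; rewrite /tensor (bigD1 i)//= out ?mul0r//.
  apply: contra_notN xi; rewrite /= in_itv/= => /andP[/ltW -> /ltW ->].
  by [].
Qed.

End tensor.

(** * Boxes and the density of bumps in L^2 *)

Lemma coord_le_norm (R : realType) n (x : 'rV[R]_n) i : `|x ord0 i| <= `|x|.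
Proof.
have -> : `|x| = mx_norm x by [].
by rewrite mx_normrE; apply: (le_trans _ (le_bigmax _ _ (ord0, i))).
Qed.

Section boxes.
Context {R : realType} {N : nat}.
Local Notation E := 'rV[R]_N.
Local Notation mu := (@lebesgue_rV R N).

Definition box (a b : 'I_N -> R) : set E :=
  [set x | forall i, a i < x ord0 i < b i].

Lemma measurable_box a b : measurable (box a b).
Proof.
rewrite (_ : box a b = \bigcap_(i in [set: 'I_N])
    ((fun x : E => x ord0 i) @^-1` `]a i, b i[)).
  apply: fin_bigcap_measurable => // i _; rewrite -[X in measurable X]setTI.
  exact: measurable_rV_coord.
apply/seteqP; split=> x; first by move=> h i _; rewrite /= in_itv/= h.
by move=> h i; have := h i Logic.I; rewrite /= in_itv.
Qed.

Definition boxes : set (set E) := [set A | exists a b, A = box a b].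

Lemma setI_closed_boxes : setI_closed boxes.
Proof.
move=> _ _ [a [b ->]] [c [e ->]].
exists (fun i => Num.max (a i) (c i)), (fun i => Num.min (b i) (e i)).
apply/seteqP; split=> x.
  move=> [h1 h2] i; have /andP[h3 h4] := h1 i; have /andP[h5 h6] := h2 i.
  by rewrite gt_max lt_min h3 h4 h5 h6.
by move=> h; split=> i; have := h i; rewrite gt_max lt_min
  => /andP[/andP[h1 h2] /andP[h3 h4]]; apply/andP.
Qed.

(** A half-space bounded in one coordinate only is an increasing union of boxes,
    and such half-spaces generate the preimages of Borel sets. *)
Lemma measurable_boxesE : @measurable _ E = <<s boxes >>.
Proof.
apply/seteqP; split; last first.
  apply: smallest_sub; first exact: sigma_algebra_measurable.
  by move=> _ [a [b ->]]; exact: measurable_box.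
apply: smallest_sub; first exact: smallest_sigma_algebra.
rewrite -bigcup_seq => A [i _ [B mB <-]].
have : measurable_fun [set: g_sigma_algebraType boxes] (fun x : E => x ord0 i).
  apply: (measurability _ (RGenOInfty.measurableE R)) => //.
  move=> _ [_ [y ->] <-]; rewrite setTI.
  rewrite (_ : _ @^-1` _ = \bigcup_n box
      (fun j => if j == i then y else - n%:R) (fun=> n%:R)).
    apply: bigcupT_measurable => n; apply: sub_sigma_algebra.
    by exists (fun j => if j == i then y else - n%:R), (fun=> n%:R).
  apply/seteqP; split => x /=.
    rewrite in_itv/= andbT => yx.
    exists (Num.truncn `|x|).+1 => // j.
    have : `|x ord0 j| < (Num.truncn `|x|).+1%:R.
      apply: le_lt_trans (truncnS_gt _).
      exact: coord_le_norm.
    rewrite ltr_norml => /andP[h1 h2].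
    by case: eqP h1 h2 => [->|_] h1 h2; apply/andP; split.
  by move=> [n _ /(_ i)]; rewrite eqxx in_itv/= andbT => /andP[].
by move=> /(_ measurableT B mB); rewrite setTI.
Qed.

End boxes.

Lemma rV_cons0 (R : realType) n (x : R) (y : 'rV[R]_n) :
  rV_cons (x, y) ord0 ord0 = x.
Proof. exact: (congr1 fst (rV_consK (x, y))). Qed.

Lemma rV_consS (R : realType) n (x : R) (y : 'rV[R]_n) j :
  rV_cons (x, y) ord0 (rshift 1 j) = y ord0 j.
Proof.
by have /rowP/(_ j) := congr1 snd (rV_consK (x, y)); rewrite /= mxE.
Qed.

Lemma lebesgue_cube_lty (R : realType) n (M : R) :
  (lebesgue_rV n (box (fun=> - M)%R (fun=> M)) < +oo)%E.
Proof.
elim: n => [|n IH]; first by rewrite /= diracE ltry.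
rewrite -[X in lebesgue_rV _ X]setIT -integral_indic//; last exact: measurable_box.
rewrite ge0_integral_rV_cons//; last first.
  by apply/measurable_EFinP/measurable_indic; exact: measurable_box.
rewrite (eq_integral (fun x : measurableTypeR R => (\1_(`](- M)%R, M[%classic) x)%:E *
    lebesgue_rV n (box (fun=> - M)%R (fun=> M)))%E); last first.
  move=> x _; rewrite -[X in lebesgue_rV _ X]setIT -integral_indic//; last first.
    exact: measurable_box.
  rewrite -ge0_integralZl//; last first.
    by apply/measurable_EFinP/measurable_indic; exact: measurable_box.
  apply: eq_integral => y _; rewrite -EFinM !indicE -natrM mulnb.
  congr (_%:R%:E); apply: congr1; apply/idP/idP.
    rewrite !inE => h; apply/andP; split; rewrite inE.
      by have := h ord0; rewrite rV_cons0 /= in_itv.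
    by move=> j; have := h (rshift 1 j); rewrite rV_consS.
  rewrite !inE => /andP[]; rewrite !inE/= in_itv/= => xM yM j.
  case: (split_ordP (m := 1) (n := n) j) => i ->; last by rewrite rV_consS; exact: yM.
  by rewrite (_ : lshift n i = ord0) ?rV_cons0//; apply/val_inj; rewrite /= ord1.
rewrite ge0_integralZr//; last exact/measurable_EFinP/measurable_indic.
rewrite integral_indic// setIT lte_mul_pinfty// ge0_fin_numE//.
rewrite -[X in (X < _)%E]/(lebesgue_measure `](- M)%R, M[%classic).
by rewrite lebesgue_measure_itv/=; case: ifP => // _; rewrite ltry.
Qed.

Section bump_density.
Context {R : realType} {N : nat}.
Local Notation E := 'rV[R]_N.
Local Notation mu := (@lebesgue_rV R N).
Local Notation L2 := (Lfun mu 2%:E).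

Definition bumps (a b : 'I_N -> R) k : E -> R :=
  tensor (fun i => bump (a i) (b i) k).

Lemma test_function_bumps a b k : test_function (bumps a b k).
Proof.
apply: (@test_function_tensor _ _ _ a b) => [j|i x]; first exact: smooth_bump.
exact: bump_out.
Qed.

Lemma indic_boxE a b (x : E) : \1_(box a b) x = \prod_i (a i < x ord0 i < b i)%R%:R :> R.
Proof.
rewrite indicE; have [xb|/existsNP[i xi]] := pselect (box a b x).
  by rewrite mem_set// big1// => i _; rewrite xb.
rewrite memNset; last by move=> /(_ i).
rewrite (bigD1 i)//= (_ : (_ < _ < _) = false) ?mul0r//.
exact/negbTE/negP.
Qed.

Lemma box_lty a b : (mu (box a b) < +oo)%E.
Proof.
pose M : R := \sum_i (`|a i| + `|b i|).
apply: le_lt_trans (lebesgue_cube_lty N M).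
apply: le_measure; rewrite ?inE; [exact: measurable_box..|].
move=> x h i; have /andP[ax xb] := h i.
have : `|a i| + `|b i| <= M.
  rewrite /M (bigD1 i)//= lerDl; apply: sumr_ge0 => j _.
  by rewrite addr_ge0.
have := ler_norm (b i); have := ler_norm (- a i); rewrite normrN.
have := normr_ge0 (a i); have := normr_ge0 (b i).
by move=> *; apply/andP; split; lra.
Qed.

Lemma indic_box_Lfun2 a b : (\1_(box a b) : E -> R) \in L2.
Proof. by apply: indic_Lfun2; [exact: measurable_box|exact: box_lty]. Qed.

Lemma bumps_ge0 a b k x : 0 <= bumps a b k x.
Proof. by apply: prodr_ge0 => i _; exact: bump_ge0. Qed.

Lemma bumps_le_indic a b k x : bumps a b k x <= \1_(box a b) x.
Proof.
rewrite indic_boxE; apply: ler_prod => i _; rewrite bump_ge0/=.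
have [_|axb] := boolP (_ < _ < _); first exact: bump_le1.
by rewrite bump_out.
Qed.

Lemma continuous_bumps a b k : continuous (bumps a b k).
Proof.
by apply: continuous_tensor => j; apply: smooth_continuous; exact: smooth_bump.
Qed.

Lemma bumps_Lfun2 a b k : bumps a b k \in L2.
Proof.
apply: (Lfun2_le _ (indic_box_Lfun2 a b)).
  by apply: continuous_measurable_rV; exact: continuous_bumps.
move=> x; rewrite !ger0_norm ?bumps_ge0 ?bumps_le_indic//.
Qed.

(** As [k] grows the bumps increase to the indicator of a box, and boxes form a
    generating pi-system, so that the general density principle applies. *)
Lemma L2_closed_bumps (P : set (E -> R)) : L2_closed mu P ->
  (forall a b k, P (bumps a b k)) -> forall f, f \in L2 -> P f.
Proof.
move=> cP Pb; apply: (L2_closed_density cP measurable_boxesE setI_closed_boxes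
  (Q := fun n => box (fun=> - n%:R) (fun=> n%:R))).
- by move=> n; exists (fun=> - n%:R), (fun=> n%:R).
- by move=> n; exact: lebesgue_cube_lty.
- move=> x; exists (Num.truncn `|x|).+1 => // n /= xn j.
  rewrite -ltr_norml.
  apply: (@lt_le_trans _ _ (Num.truncn `|x|).+1%:R); last by rewrite ler_nat.
  apply: le_lt_trans (truncnS_gt _).
  exact: coord_le_norm.
- move=> _ [a [b ->]]; have [_ _ Plim] := cP.
  apply: (Plim (bumps a b)) => //.
  + by move=> k; exact: bumps_Lfun2.
  + exact: indic_box_Lfun2.
  apply: (Lfun2_dominated_cvg (g := \1_(box a b))).
  + by move=> k; apply: continuous_measurable_rV; exact: continuous_bumps.
  + by apply: measurable_indic; exact: measurable_box.
  + exact: indic_box_Lfun2.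
  + move=> x; rewrite indic_boxE.
    by apply: cvg_tensor => i; exact: bump_cvg.
  + move=> k x; rewrite ler0_norm ?subr_le0 ?bumps_le_indic// opprB.
    by rewrite gerBl bumps_ge0.
Qed.

(** Orthogonality to [f] is a closed condition satisfied by the bumps, hence by
    [f] itself: this is the fundamental lemma of the calculus of variations. *)
Lemma bumps_orthogonal_eq0 (f : E -> R) : f \in L2 ->
  (forall a b k, \int[mu]_x (f x * bumps a b k x) = 0) -> f = cst 0 %[ae mu].
Proof.
move=> fL fb; apply: Rintegral_sqr_eq0 => //; under eq_Rintegral do rewrite expr2.
apply: (L2_closed_bumps (P := fun h => \int[mu]_x (f x * h x) = 0) _ _ fL).
  split=> [g h gL hL g0 h0|c g gL g0|F g FL gL F0 Fg].
  - under eq_Rintegral do rewrite mulrDr.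
    by rewrite RintegralD ?g0 ?h0 ?addr0//; exact: Lfun2_integrableM.
  - under eq_Rintegral do rewrite mulrCA.
    by rewrite RintegralZl ?g0 ?mulr0//; exact: Lfun2_integrableM.
  - exact: cvg_Rintegral_orthogonal Fg.
exact: fb.
Qed.

End bump_density.

(** * Test functions and dilations *)

Section test_function_theory.
Context {R : realType} {N : nat}.
Local Notation E := 'rV[R]_N.
Local Notation mu := (@lebesgue_rV R N).
Local Notation L2 := (Lfun mu 2%:E).
Implicit Types (u psi : E -> R) (v : E -> E).

Lemma test_function_continuous psi : test_function psi -> continuous psi.
Proof. by move=> [/(_ [::])]. Qed.

(** Outside a compact support the function vanishes on an open set, and so does
    its derivative. *)
Lemma test_function_partial i psi :
  test_function psi -> test_function (partial i psi).
Proof.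
have iterE s : iter_partial s (partial i psi) = iter_partial (rcons s i) psi.
  by rewrite /iter_partial foldr_rcons.
move=> [ctp dtp [K cK K0]]; split=> [s|s j x|].
- by rewrite iterE; exact: ctp.
- by rewrite iterE; exact: dtp.
exists K => // x nKx; rewrite /partial.
have oK : open (~` K) by rewrite openC; exact: compact_closed.
rewrite (near_eq_derive (g := cst 0)) ?derive_cst//.
have : nbhs x (~` K) by exact: open_nbhs_nbhs.
by apply: filterS => y; exact: K0.
Qed.

Lemma compact_lty (K : set E) : compact K -> (mu K < +oo)%E.
Proof.
move=> cK; have [M [_ MK]] := compact_bounded cK.
apply: le_lt_trans (lebesgue_cube_lty N (M + 2)).
apply: le_measure; rewrite ?inE.
- exact: compact_measurable_rV.
- exact: measurable_box.
move=> x Kx i; rewrite -ltr_norml; apply: le_lt_trans (coord_le_norm x i) _.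
by apply: (le_lt_trans (MK (M + 1) _ x Kx)); rewrite ?ltrDl// ltrD2l ltr1n.
Qed.

(** Square integrability of test functions is what allows the defining identity
    of weak gradients to be subtracted. *)
Lemma test_function_Lfun2 psi : test_function psi -> psi \in L2.
Proof.
move=> tp; have ctp := test_function_continuous tp; have [_ _ [K cK K0]] := tp.
have [M [_ MK]] : bounded_set (psi @` K).
  apply: compact_bounded; apply: continuous_compact => //.
  exact: continuous_subspaceT.
apply: (@Lfun2_le _ _ _ _ _ (fun x => (`|M| + 1) * \1_K x)).
- exact: continuous_measurable_rV.
- apply: Lfun2Z; apply: indic_Lfun2; first exact: compact_measurable_rV.
  exact: compact_lty.
- move=> x; rewrite indicE; have [Kx|nKx] := pselect (K x); last first.
    by rewrite K0// normr0.
  rewrite mem_set// mulr1 [leRHS]ger0_norm ?addr_ge0//.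
  apply: MK; last by exists x.
  by apply: le_lt_trans (ler_norm M) _; rewrite ltrDl.
Qed.

(** A directional derivative is the derivative of a function of one variable, to
    which the chain rule for affine maps applies. *)
Lemma is_derive_dilate psi (c : R) (x w : E) : derivable psi (c *: x) w ->
  is_derive x w (dilate psi c) (c * 'D_w psi (c *: x)).
Proof.
move=> dp.
pose g h := psi (h *: w + c *: x).
have gE : (fun h => dilate psi c (h *: w + x)) = fun h => g (c * h + 0).
  by apply/funext => h; rewrite /dilate /g addr0 scalerDr scalerA.
have dg : derivable g (c * 0 + 0) 1.
  by rewrite mulr0 addr0; exact: (derivable1P psi (c *: x) w).1 dp.
have [dh h] := is_derive_affine dg.
have D0 (f : E -> R) (y : E) : 'D_w f y = 'D_1 (fun h : R => f (h *: w + y)) 0.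
  rewrite /derive; set g1 := fun h => h^-1 *: _; set g2 := fun h => h^-1 *: _.
  suff -> : g1 = g2 by [].
  by rewrite funeqE /g1 /g2 => k /=; rewrite addr0 scale0r add0r [_%:A]mulr1.
apply: DeriveDef; first by apply/derivable1P; rewrite gE.
by rewrite D0 gE h mulr0 addr0 derive1E D0.
Qed.

Lemma iter_partial_dilate psi (c : R) s : test_function psi ->
  iter_partial s (dilate psi c) =
  fun x => c ^+ size s * iter_partial s psi (c *: x).
Proof.
move=> [_ dtp _]; elim: s => [|i s IH]; first by apply/funext => x; rewrite mul1r.
apply/funext => x; rewrite /= -/(iter_partial s _) IH /partial.
have dx := dtp s i (c *: x).
have := is_deriveZ (c ^+ size s) (is_derive_dilate dx).
by move=> [_ h]; rewrite [LHS]h /GRing.scale/= exprSr -mulrA.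
Qed.

Lemma partial_dilate psi (c : R) i x : test_function psi ->
  partial i (dilate psi c) x = c * partial i psi (c *: x).
Proof.
move=> tp; have := congr1 (fun f => f x) (iter_partial_dilate c [:: i] tp).
by rewrite /= expr1.
Qed.

Lemma scale_continuous (c : R) : continuous (fun x : E => c *: x).
Proof. exact: scaler_continuous. Qed.

Lemma test_function_dilate psi (c : R) : 0 < c -> test_function psi ->
  test_function (dilate psi c).
Proof.
move=> c0 tp; have [ctp dtp [K cK K0]] := tp; split=> [s|s i x|].
- rewrite iter_partial_dilate//.
  have ci : continuous (fun x : E => iter_partial s psi (c *: x)).
    move=> x; apply: (@continuous_comp _ _ _ (fun x : E => c *: x)).
      exact: scale_continuous.
    exact: ctp.
  move=> x.
  exact: (@cvgM _ _ (nbhs x) _ (fun=> c ^+ size s) _ _ _ (cvg_cst _) (ci x)).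
- rewrite iter_partial_dilate//.
  have [dx _] := is_deriveZ (c ^+ size s) (is_derive_dilate (dtp s i (c *: x))).
  exact: dx.
- exists ((fun x : E => c^-1 *: x) @` K).
    by apply: continuous_compact => //; apply: continuous_subspaceT;
      exact: scale_continuous.
  move=> x nx; apply: K0 => Kx; apply: nx; exists (c *: x) => //.
  by rewrite scalerA mulVf ?scale1r// gt_eqF.
Qed.

(** The change of variables that moves the dilation from one factor to the
    other, with the inverse parameter. *)
Lemma Rintegral_dilate_mul (s : R) (f g : E -> R) : 0 < s ->
  measurable_fun setT f -> measurable_fun setT g ->
  \int[mu]_x (f (s *: x) * g x) = s ^- N * \int[mu]_x (f x * dilate g s^-1 x).
Proof.
move=> s0 mf mg.
have mfg : measurable_fun setT (fun x => f x * dilate g s^-1 x).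
  apply: measurable_funM => //.
  have := measurableT_comp mg (measurable_affine_rV s^-1 (0 : E)).
  by under eq_fun do rewrite /= addr0.
rewrite -(Rintegral_affine 0 s0 mfg); apply: eq_Rintegral => x _.
by rewrite /dilate addr0 scalerA mulVf ?scale1r// gt_eqF.
Qed.

Lemma measurable_dilate (f : E -> R) s :
  measurable_fun setT f -> measurable_fun setT (dilate f s).
Proof.
move=> mf; have := measurableT_comp mf (measurable_affine_rV s (0 : E)).
by under eq_fun do rewrite /= addr0.
Qed.

Lemma Rintegral_dilate (f : E -> R) s : 0 < s -> measurable_fun setT f ->
  \int[mu]_x (dilate f s x) = s ^- N * \int[mu]_x (f x).
Proof.
move=> s0 mf; rewrite -(Rintegral_affine 0 s0 mf).
by apply: eq_Rintegral => x _; rewrite addr0.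
Qed.

Lemma integrable_dilate (f : E -> R) s : 0 < s ->
  mu.-integrable setT (EFin \o f) -> mu.-integrable setT (EFin \o dilate f s).
Proof.
move=> s0 /(integrable_affine 0 s0).
by under eq_fun do rewrite /= addr0.
Qed.

Lemma dilate_Lfun2 (f : E -> R) s : 0 < s -> f \in L2 -> dilate f s \in L2.
Proof.
move=> s0 /Lfun2P[mf if2]; apply/Lfun2P; split; first exact: measurable_dilate.
exact: (integrable_dilate (f := fun x => f x ^+ 2)).
Qed.

Lemma Rintegral_sqr_dilate (f : E -> R) s : 0 < s -> measurable_fun setT f ->
  \int[mu]_x (dilate f s x ^+ 2) = s ^- N * \int[mu]_x (f x ^+ 2).
Proof.
move=> s0 mf; rewrite -(Rintegral_dilate (f := fun x => f x ^+ 2))//.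
exact: measurable_funX.
Qed.

Lemma dilate_eq0 (f : E -> R) s : 0 < s -> f \in L2 ->
  dilate f s = cst 0 %[ae mu] -> f = cst 0 %[ae mu].
Proof.
move=> s0 fL sf0; have [mf _] := (Lfun2P mu f).1 fL.
apply: Rintegral_sqr_eq0 => //.
have L0 : (cst 0 : E -> R) \in L2.
  by have := Lfun2Z 0 fL; under eq_fun do rewrite mul0r.
have := eq_Rintegral_sqr (dilate_Lfun2 s0 fL) L0 sf0.
rewrite Rintegral_sqr_dilate//.
under [X in _ = X -> _]eq_Rintegral do rewrite expr0n/=.
rewrite Rintegral_cst// mul0r => /eqP; rewrite mulf_eq0 invr_eq0 expf_eq0.
by rewrite (gt_eqF s0) andbF => /eqP.
Qed.

(** Dilation parameters are recovered from the L^2 norm, so that distinct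
    parameters give functions that are not almost everywhere equal. *)
Lemma dilate_inj (f : E -> R) s t : (0 < N)%N -> 0 < s -> 0 < t -> f \in L2 ->
  ~ f = cst 0 %[ae mu] -> dilate f s = dilate f t %[ae mu] -> s = t.
Proof.
move=> N0 s0 t0 fL f0 st; have mf := Lfun2_measurable fL.
have := eq_Rintegral_sqr (dilate_Lfun2 s0 fL) (dilate_Lfun2 t0 fL) st.
rewrite !Rintegral_sqr_dilate// => /mulIf; move=> /(_ _)/invr_inj h.
apply/eqP; rewrite -(@eqrXn2 _ N)//; [|exact: ltW..].
apply/eqP/h; apply: contra_notN f0 => /eqP.
exact: Rintegral_sqr_eq0.
Qed.

End test_function_theory.

(** * Weak gradients, the Kirchhoff equation and dilations *)

Section weak_gradient_theory.
Context {R : realType} {N : nat}.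
Local Notation E := 'rV[R]_N.
Local Notation mu := (@lebesgue_rV R N).
Local Notation L2 := (Lfun mu 2%:E).
Implicit Types (u psi : E -> R) (v w : E -> E).

Lemma Rintegral_sum d (T : measurableType d) (m : {measure set T -> \bar R}) n
    (F : 'I_n -> T -> R) :
  (forall i, m.-integrable setT (EFin \o F i)) ->
  m.-integrable setT (EFin \o (fun x => \sum_i F i x)) /\
  \int[m]_x (\sum_i F i x) = \sum_i \int[m]_x F i x.
Proof.
elim: n F => [|n IH] F iF.
  under eq_fun do rewrite big_ord0; rewrite big_ord0.
  split; first exact: integrable0.
  by rewrite Rintegral_cst// mul0r.
have [iS eS] := IH (fun i => F (lift ord0 i)) (fun i => iF _).
under eq_fun do rewrite big_ord_recl.
split; first exact: integrable_EFinD.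
by rewrite RintegralD// eS big_ord_recl.
Qed.

Lemma ae_eq_RintegralM (f g h : E -> R) : f \in L2 -> g \in L2 -> h \in L2 ->
  f = g %[ae mu] -> \int[mu]_x (f x * h x) = \int[mu]_x (g x * h x).
Proof.
move=> fL gL hL fg; congr fine; apply: ae_eq_integral => //.
- exact: measurable_int (Lfun2_integrableM fL hL).
- exact: measurable_int (Lfun2_integrableM gL hL).
- by apply: filterS fg => x /= fgx _; rewrite fgx.
Qed.

(** Two weak gradients have the same integrals against all test functions, in
    particular against bumps. *)
Lemma weak_gradient_unique u v w i : weak_gradient u v -> weak_gradient u w ->
  (fun x => v x ord0 i) = (fun x => w x ord0 i) %[ae mu].
Proof.
move=> [vL vE] [wL wE].
have /= h := bumps_orthogonal_eq0 (Lfun2B (vL i) (wL i)).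
have : (fun x => v x ord0 i - w x ord0 i) = cst 0 %[ae mu].
  apply: h => a b k; under eq_Rintegral do rewrite mulrBl.
  have tb := test_function_bumps a b k.
  rewrite RintegralB//; [|exact/Lfun2_integrableM/bumps_Lfun2..].
  have := vE _ tb i; rewrite (wE _ tb i) => /oppr_inj ->.
  by rewrite subrr.
by apply: filterS => x /= vw _; apply/eqP; rewrite -subr_eq0 vw.
Qed.


(** The gradient in the definition of [dirichlet] is an arbitrary choice; by
    uniqueness the integral may be computed with any weak gradient. *)
Lemma dirichletE u v : weak_gradient u v ->
  dirichlet u = \sum_i \int[mu]_x (v x ord0 i ^+ 2).
Proof.
move=> uv; have ug : weak_gradient u (grad u) by apply: xgetPex; exists v.
rewrite /dirichlet /dotp.
have [_ ->] := Rintegral_sum (fun i => Lfun2_integrableM (ug.1 i) (ug.1 i)).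
apply: eq_bigr => i _; under eq_Rintegral do rewrite -expr2.
apply: eq_Rintegral_sqr; [exact: ug.1|exact: uv.1|].
exact: weak_gradient_unique ug uv.
Qed.

Lemma dirichlet_ge0 u : 0 <= dirichlet u.
Proof.
apply: Rintegral_ge0 => x _; apply: sumr_ge0 => i _.
by rewrite -expr2 sqr_ge0.
Qed.

Lemma Rintegral_dotp_grad u v psi : weak_gradient u v -> test_function psi ->
  \int[mu]_x dotp (grad u x) (\row_i partial i psi x) =
  \sum_i \int[mu]_x (v x ord0 i * partial i psi x).
Proof.
move=> uv tp; have ug : weak_gradient u (grad u) by apply: xgetPex; exists v.
have pL i : partial i psi \in L2.
  by apply: test_function_Lfun2; exact: test_function_partial.
rewrite /dotp; under eq_Rintegral do under eq_bigr do rewrite mxE.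
have [_ ->] := Rintegral_sum (fun i => Lfun2_integrableM (ug.1 i) (pL i)).
apply: eq_bigr => i _; apply: ae_eq_RintegralM => //; [exact: ug.1|exact: uv.1|].
exact: weak_gradient_unique ug uv.
Qed.

Lemma weak_gradientB u1 u2 v1 v2 : u1 \in L2 -> u2 \in L2 ->
  weak_gradient u1 v1 -> weak_gradient u2 v2 ->
  weak_gradient (fun x => u1 x - u2 x) (fun x => v1 x - v2 x).
Proof.
move=> u1L u2L [v1L e1] [v2L e2]; split=> [i|psi tp i].
  by under eq_fun do rewrite !mxE; exact: Lfun2B.
have pL : partial i psi \in L2.
  by apply: test_function_Lfun2; exact: test_function_partial.
have tL := test_function_Lfun2 tp.
under eq_Rintegral do rewrite mulrBl.
under [X in _ = - X]eq_Rintegral do rewrite !mxE mulrBl.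
rewrite !RintegralB//; [|exact: Lfun2_integrableM..].
by rewrite e1// e2// opprB addrC opprK.
Qed.

Lemma dilate_partial psi i s x : 0 < s -> test_function psi ->
  dilate (partial i psi) s^-1 x = s * partial i (dilate psi s^-1) x.
Proof.
move=> s0 tp; rewrite partial_dilate// mulrA divff ?mul1r//.
by rewrite gt_eqF.
Qed.

Lemma Rintegral_dilate_partial (f : E -> R) psi i s : 0 < s -> f \in L2 ->
  test_function psi ->
  \int[mu]_x (f (s *: x) * partial i psi x) =
  s ^- N * s * \int[mu]_x (f x * partial i (dilate psi s^-1) x).
Proof.
move=> s0 fL tp; have sV0 : 0 < s^-1 by rewrite invr_gt0.
have mp : measurable_fun setT (partial i psi).
  apply: continuous_measurable_rV; apply: test_function_continuous.
  exact: test_function_partial.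
rewrite (Rintegral_dilate_mul s0 (Lfun2_measurable fL) mp).
rewrite -mulrA; congr (_ * _).
under eq_Rintegral do rewrite dilate_partial// mulrCA.
rewrite RintegralZl//; apply: Lfun2_integrableM => //.
by apply/test_function_Lfun2/test_function_partial; exact: test_function_dilate.
Qed.

(** Move the dilation to the test function, use the definition for the dilated
    test function, and move it back: the partial derivative picks up the
    factor [s]. *)
Lemma weak_gradient_dilate u v s : 0 < s -> u \in L2 -> weak_gradient u v ->
  weak_gradient (dilate u s) (fun x => s *: v (s *: x)).
Proof.
move=> s0 uL [vL vE]; have sV0 : 0 < s^-1 by rewrite invr_gt0.
have vsL i : (fun x => v (s *: x) ord0 i) \in L2.
  exact: (dilate_Lfun2 s0 (vL i)).
split=> [i|psi tp i]; first by under eq_fun do rewrite mxE; exact: Lfun2Z.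
rewrite Rintegral_dilate_partial// vE; last exact: test_function_dilate.
under [X in _ = - X]eq_Rintegral do rewrite mxE -mulrA.
rewrite RintegralZl//; last first.
  by apply: Lfun2_integrableM => //; exact: test_function_Lfun2.
have mp := continuous_measurable_rV (test_function_continuous tp).
rewrite (Rintegral_dilate_mul s0 (Lfun2_measurable (vL i)) mp).
by rewrite mulrN mulrA [s * _]mulrC.
Qed.

Lemma H1_dilate u s : 0 < s -> H1 u -> H1 (dilate u s).
Proof.
move=> s0 [uL [v uv]]; split; first exact: dilate_Lfun2.
by exists (fun x => s *: v (s *: x)); exact: weak_gradient_dilate.
Qed.

Lemma dirichlet_dilate u s : 0 < s -> H1 u ->
  dirichlet (dilate u s) = s ^+ 2 * s ^- N * dirichlet u.
Proof.
move=> s0 [uL [v uv]].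
rewrite (dirichletE uv) (dirichletE (weak_gradient_dilate s0 uL uv)) mulr_sumr.
apply: eq_bigr => i _; under eq_Rintegral do rewrite mxE exprMn.
have vsL := dilate_Lfun2 s0 (uv.1 i).
rewrite RintegralZl//; last by have [] := (Lfun2P _ _).1 vsL.
rewrite -mulrA -(Rintegral_sqr_dilate (f := fun x => v x ord0 i))//.
exact/Lfun2_measurable/uv.1.
Qed.

(** One factor [s] comes from the gradient of the dilate and another from the
    gradient of the dilated test function, while both sides share the Jacobian
    [s^-N]. *)
Lemma weak_solution_dilate (c s : R) (g : R -> R) u : 0 < s -> c * s ^+ 2 = 1 ->
  continuous g -> H1 u -> weak_solution 1 g u -> weak_solution c g (dilate u s).
Proof.
move=> s0 cs cg [uL [v uv]] [iu wu].
have mgu : measurable_fun setT (g \o u).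
  apply: measurableT_comp; first exact: continuous_measurable_fun.
  exact: (Lfun2_measurable uL).
split=> [K cK|psi tp].
  pose K' := (fun x : E => s *: x) @` K.
  have cK' : compact K'.
    by apply: continuous_compact => //; apply: continuous_subspaceT;
      exact: scale_continuous.
  have /integrable_mkcond := iu K' cK'.
  move=> /(_ (compact_measurable_rV cK')) h.
  apply/(integrable_mkcond _ (compact_measurable_rV cK)).
  have := integrable_affine 0 s0 h; congr (integrable _ _ _).
  apply/funext => x; rewrite addr0 !patchE.
  suff -> : (s *: x \in K') = (x \in K) by [].
  apply/idP/idP; rewrite !inE; last by exists x.
  by move=> [y Ky /scalerI <-//]; rewrite gt_eqF.
have sV0 : 0 < s^-1 by rewrite invr_gt0.
have tr := test_function_dilate sV0 tp.
rewrite (Rintegral_dotp_grad (weak_gradient_dilate s0 uL uv) tp).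
have mp := continuous_measurable_rV (test_function_continuous tp).
rewrite (Rintegral_dilate_mul s0 mgu mp).
rewrite -(wu _ tr) mul1r (Rintegral_dotp_grad uv tr).
transitivity (c * s ^+ 2 * (s ^- N *
    \sum_i \int[mu]_x (v x ord0 i * partial i (dilate psi s^-1) x))); last first.
  by rewrite cs mul1r.
rewrite -mulrA; congr (_ * _); rewrite mulrA mulr_sumr.
apply: eq_bigr => i _; under eq_Rintegral do rewrite mxE -mulrA.
have iv : mu.-integrable setT
    (EFin \o (fun x => v (s *: x) ord0 i * partial i psi x)).
  apply: (Lfun2_integrableM (dilate_Lfun2 s0 (uv.1 i))).
  by apply: test_function_Lfun2; exact: test_function_partial.
rewrite (RintegralZl s measurableT iv).
rewrite (Rintegral_dilate_partial i s0 (uv.1 i) tp).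
by move: (s ^- N) (\int[mu]_x _) => q I0; ring.
Qed.

Lemma DG_dilate (g : R -> R) u s : 0 < s -> DG g u -> DG g (dilate u s).
Proof.
move=> s0 [u1 u0 iu]; split; first exact: H1_dilate.
- by apply: contra_not u0; apply: dilate_eq0 => //; case: u1.
- exact: (integrable_dilate (f := primitive g \o u)).
Qed.

Lemma H1_sqnorm_dilateB u v s t : 0 < s -> 0 < t -> u \in L2 ->
  weak_gradient u v ->
  H1_sqnorm (fun x => dilate u s x - dilate u t x) =
  \sum_i \int[mu]_x ((s * v (s *: x) ord0 i - t * v (t *: x) ord0 i) ^+ 2) +
  \int[mu]_x ((dilate u s x - dilate u t x) ^+ 2).
Proof.
move=> s0 t0 uL uv; rewrite /H1_sqnorm; congr (_ + _).
rewrite (dirichletE (weak_gradientB (dilate_Lfun2 s0 uL) (dilate_Lfun2 t0 uL)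
  (weak_gradient_dilate s0 uL uv) (weak_gradient_dilate t0 uL uv))).
by apply: eq_bigr => i _; apply: eq_Rintegral => x _; rewrite !mxE.
Qed.

(** Dominated convergence: for parameters larger than [t / 2] the dilates of a
    bump all vanish outside one cube. *)
Lemma bumps_dilate_cvg a b k (t : R) : 0 < t ->
  \int[mu]_x ((dilate (bumps a b k) s x - dilate (bumps a b k) t x) ^+ 2)
    @[s --> t] --> (0 : R).
Proof.
move=> t0; pose M : R := (\sum_i (`|a i| + `|b i|)) / (t / 2).
pose F s x := (dilate (bumps a b k) s x - dilate (bumps a b k) t x) ^+ 2.
have M0 : 0 <= M.
  by rewrite divr_ge0//; [apply: sumr_ge0 => i _; rewrite addr_ge0|lra].
have supp s x : t / 2 < s -> ~ box (fun=> - M) (fun=> M) x ->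
    dilate (bumps a b k) s x = 0.
  move=> ts; apply: contra_notP => sx i.
  have s0 : 0 < s by lra.
  have : box a b (s *: x).
    apply: contra_notP sx => /existsNP[j sxj].
    by rewrite /dilate /bumps /tensor (bigD1 j)//= bump_out ?mul0r//; exact/negP.
  move=> /(_ i); rewrite mxE => /andP[ax xb]; rewrite -ltr_norml.
  rewrite ltr_pdivlMr; last lra.
  have h : `|a i| + `|b i| <= \sum_j (`|a j| + `|b j|).
    rewrite (bigD1 i)//= lerDl; apply: sumr_ge0 => j _.
    by rewrite addr_ge0.
  apply: lt_le_trans h; apply: (@le_lt_trans _ _ (`|x ord0 i| * s)).
    by rewrite ler_wpM2l// ltW.
  rewrite -[X in _ * X](gtr0_norm s0) -normrM mulrC ltr_norml.
  have := ler_norm (b i); have := ler_norm (- a i); rewrite normrN.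
  have := normr_ge0 (a i); have := normr_ge0 (b i).
  by move=> *; apply/andP; split; lra.
have F_le s x : t / 2 < s -> `|F s x| <= \1_(box (fun=> - M) (fun=> M)) x ^+ 2.
  move=> ts; rewrite /F ger0_norm ?sqr_ge0// indicE.
  have [xM|xM] := pselect (box (fun=> - M) (fun=> M) x); last first.
    rewrite (supp s)// (supp t)//; last lra.
    by rewrite subrr expr0n/= sqr_ge0.
  rewrite mem_set// mulr1n -[leLHS]real_normK ?num_real//.
  have le1 r : dilate (bumps a b k) r x <= 1.
    apply: le_trans (bumps_le_indic _ _ _ _) _.
    by rewrite indicE lern1 leq_b1.
  have := le1 s; have := le1 t; have := bumps_ge0 a b k (s *: x).
  have := bumps_ge0 a b k (t *: x); rewrite /dilate => h1 h2 h3 h4.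
  by rewrite lerXn2r// ?nnegrE// ler_norml; apply/andP; split; lra.
have mb := continuous_measurable_rV (@continuous_bumps R N a b k).
have mF s : measurable_fun setT (F s).
  apply: measurable_funX; apply: measurable_funB; exact: measurable_dilate.
have [_ iM] := (Lfun2P mu _).1 (indic_box_Lfun2 (fun=> - M) (fun=> M)).
have Ft0 : \int[mu]_x F t x = 0.
  rewrite /F; under eq_Rintegral do rewrite subrr expr0n/=.
  by rewrite Rintegral_cst// mul0r.
suff : \int[mu]_x F s x @[s --> t] --> \int[mu]_x F t x by rewrite Ft0.
apply: (@continuity_under_integral R _ E mu F setT measurableT (t / 2) (2 * t)
  _ _ _ iM _ t).
- move=> s; rewrite /= in_itv/= => /andP[ts _].
  apply: le_integrable iM => //; first exact/measurable_EFinP.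
  move=> x _ /=; rewrite lee_fin [leRHS]ger0_norm ?sqr_ge0//; exact: F_le.
- apply: aeW => x _ s _; rewrite /F.
  have cb : continuous (fun s : R => dilate (bumps a b k) s x).
    move=> r; apply: (@continuous_comp _ _ _ (fun s : R => s *: x)).
      exact: scalel_continuous.
    exact: continuous_bumps.
  have cB : (fun s : R => dilate (bumps a b k) s x - dilate (bumps a b k) t x) @ s
     --> dilate (bumps a b k) s x - dilate (bumps a b k) t x.
    by apply: cvgB; [exact: cb|exact: cvg_cst].
  apply: (@cvg_comp _ _ _ _ (fun y : R => y ^+ 2) _ _ _ cB).
  exact: exprn_continuous.
- move=> s; rewrite /= in_itv/= => /andP[ts _].
  by apply: aeW => x _; exact: F_le.
- by rewrite inE/= in_itv/=; apply/andP; split; lra.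
Qed.

(** Dilation is continuous in L^2: true for bumps, and the property passes to
    limits because dilations with parameter bounded away from 0 are uniformly
    bounded operators. *)
Lemma dilate_cvg (f : E -> R) (t : R) : 0 < t -> f \in L2 ->
  \int[mu]_x ((dilate f s x - dilate f t x) ^+ 2) @[s --> t] --> (0 : R).
Proof.
move=> t0; apply: (L2_closed_bumps (P := fun f =>
  \int[mu]_x ((dilate f s x - dilate f t x) ^+ 2) @[s --> t] --> (0 : R))); last first.
  by move=> a b k; exact: bumps_dilate_cvg.
have BL s h : 0 < s -> h \in L2 -> (fun x => dilate h s x - dilate h t x) \in L2.
  by move=> s0 hL; apply: Lfun2B; exact: dilate_Lfun2.
split=> [h1 h2 h1L h2L h10 h20|c h hL h0|F h FL hL F0 Fh].
- apply: (@squeeze_cvgr _ _ _ _ (cst 0) (fun s =>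
    2 * \int[mu]_x ((dilate h1 s x - dilate h1 t x) ^+ 2) +
    2 * \int[mu]_x ((dilate h2 s x - dilate h2 t x) ^+ 2))).
  + near=> s; have s0 : 0 < s by near: s; exact: lt_nbhsr.
    rewrite sqr_Rintegral_ge0/=.
    apply: le_trans (Rintegral_sqrD_le (BL _ _ s0 h1L) (BL _ _ s0 h2L)).
    by rewrite le_eqVlt; apply/orP; left; apply/eqP/eq_Rintegral => x _;
      rewrite /dilate; congr (_ ^+ 2); ring.
  + exact: cvg_cst.
  + have : 2 * \int[mu]_x ((dilate h1 s x - dilate h1 t x) ^+ 2) +
      2 * \int[mu]_x ((dilate h2 s x - dilate h2 t x) ^+ 2) @[s --> t] -->
      2 * 0 + 2 * (0 : R).
      by apply: cvgD; apply: cvgM => //; exact: cvg_cst.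
    by rewrite mulr0 addr0.
- apply: (@cvg_trans _ ((fun s => c ^+ 2 *
    \int[mu]_x ((dilate h s x - dilate h t x) ^+ 2)) @ t)); last first.
    have : c ^+ 2 * \int[mu]_x ((dilate h s x - dilate h t x) ^+ 2) @[s --> t]
      --> c ^+ 2 * (0 : R).
      by apply: cvgM => //; exact: cvg_cst.
    by rewrite mulr0.
  apply: near_eq_cvg; near=> s; have s0 : 0 < s by near: s; exact: lt_nbhsr.
  rewrite -RintegralZl//; last by have [] := (Lfun2P _ _).1 (BL _ _ s0 hL).
  by apply: eq_Rintegral => x _; rewrite /dilate -exprMn mulrBr.
- apply/cvgrPdist_le => e e0.
  (* Twice the bound for the operator [dilate . s - dilate . t] when
     [t / 2 <= s]; the summand 1 only makes [C] positive. *)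
  pose C : R := 2 * (2 * (t / 2) ^- N + 2 * t ^- N) + 1.
  have t20 : 0 < t / 2 by lra.
  have C0 : 0 < C.
    by rewrite ltr_pwDr// mulr_ge0// addr_ge0// mulr_ge0// invr_ge0 exprn_ge0// ltW.
  have [k Fk] : exists k, \int[mu]_x ((F k x - h x) ^+ 2) <= e / 2 / C.
    have e2C : 0 < e / 2 / C by rewrite !divr_gt0.
    have /cvgrPdist_le/(_ _ e2C)[k _ /(_ k (leqnn k))] := Fh.
    by rewrite sub0r normrN ger0_norm ?sqr_Rintegral_ge0// => ?; exists k.
  have e4 : 0 < e / 4 by lra.
  near=> s; have s0 : 0 < s by near: s; exact: lt_nbhsr.
  have ts : t / 2 <= s by apply: ltW; near: s; apply: lt_nbhsr; lra.
  have hs : \int[mu]_x ((dilate (F k) s x - dilate (F k) t x) ^+ 2) <= e / 4.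
    near: s; have /cvgrPdist_le/(_ _ e4) := F0 k; apply: filterS => s.
    by rewrite sub0r normrN ger0_norm// sqr_Rintegral_ge0.
  rewrite sub0r normrN ger0_norm ?sqr_Rintegral_ge0//.
  have dL := Lfun2B hL (FL k).
  have := Rintegral_sqrD_le (BL _ _ s0 dL) (BL _ _ s0 (FL k)).
  have -> : \int[mu]_x ((dilate (fun x => h x - F k x) s x
      - dilate (fun x => h x - F k x) t x
      + (dilate (F k) s x - dilate (F k) t x)) ^+ 2) =
    \int[mu]_x ((dilate h s x - dilate h t x) ^+ 2).
    by apply: eq_Rintegral => x _; rewrite /dilate; congr (_ ^+ 2); ring.
  move=> h1; apply: (le_trans h1).
  have := Rintegral_sqrD_le (dilate_Lfun2 s0 dL) (Lfun2N (dilate_Lfun2 t0 dL)).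
  under [X in _ <= _ + 2 * X -> _]eq_Rintegral do rewrite sqrrN.
  rewrite !Rintegral_sqr_dilate//; [|exact: (Lfun2_measurable dL)..].
  have -> : \int[mu]_x ((h x - F k x) ^+ 2) = \int[mu]_x ((F k x - h x) ^+ 2).
    by apply: eq_Rintegral => x _; rewrite -sqrrN opprB.
  have sN : s ^- N <= (t / 2) ^- N.
    by rewrite lef_pV2 ?posrE ?exprn_gt0// lerXn2r// ?nnegrE ltW.
  have := sqr_Rintegral_ge0 mu (fun x => F k x - h x).
  have := Fk; set q := Rintegral mu setT (fun x => (F k x - h x) ^+ 2) => qe q0.
  have : C * q <= e / 2 by rewrite mulrC -ler_pdivlMr.
  have : s ^- N * q <= (t / 2) ^- N * q by rewrite ler_wpM2r.
  have -> : C * q = 4 * ((t / 2) ^- N * q) + 4 * (t ^- N * q) + q.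
    by rewrite /C; ring.
  move: hs; move: ((t / 2) ^- N * q) (t ^- N * q) (s ^- N * q).
  move: (\int[mu]_x _) (\int[mu]_x _) => I1 I2 A B D *; lra.
Unshelve. all: by end_near. Qed.

End weak_gradient_theory.

(** * Functions with vanishing gradient *)

Section zero_gradient.
Context {R : realType} {N : nat}.
Local Notation E := 'rV[R]_N.
Local Notation mu := (@lebesgue_rV R N).
Local Notation L2 := (Lfun mu 2%:E).
Implicit Types (u psi : E -> R) (v w : E -> E).

Lemma cvg_sumr (T : Type) (F : set_system T) {FF : Filter F} n
    (f : T -> 'I_n -> R) (l : 'I_n -> R) :
  (forall i, f t i @[t --> F] --> l i) ->
  \sum_i f t i @[t --> F] --> \sum_i l i.
Proof.
move=> fl; elim: (index_enum _) => [|i r IH].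
  by under eq_fun do rewrite big_nil; rewrite big_nil; exact: cvg_cst.
under eq_fun do rewrite big_cons; rewrite big_cons.
by apply: cvgD; [exact: fl|exact: IH].
Qed.

Lemma H1_sqnorm_dilate_cvg u (t : R) : 0 < t -> H1 u ->
  H1_sqnorm (fun x => dilate u s x - dilate u t x) @[s --> t] --> (0 : R).
Proof.
move=> t0 [uL [v uv]].
have vL i := uv.1 i.
apply: (@squeeze_cvgr _ _ _ _ (cst 0) (fun s =>
  \sum_i (2 * (s ^+ 2 * \int[mu]_x ((dilate (fun x => v x ord0 i) s x -
                         dilate (fun x => v x ord0 i) t x) ^+ 2)) +
     2 * ((s - t) ^+ 2 * \int[mu]_x (dilate (fun x => v x ord0 i) t x ^+ 2))) +
  \int[mu]_x ((dilate u s x - dilate u t x) ^+ 2))).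
- near=> s; have s0 : 0 < s by near: s; exact: lt_nbhsr.
  rewrite (H1_sqnorm_dilateB s0 t0 uL uv) addr_ge0 ?sqr_Rintegral_ge0//=; last first.
    by apply: sumr_ge0 => i _; exact: sqr_Rintegral_ge0.
  rewrite lerD2r; apply: ler_sum => i _.
  have vsL := dilate_Lfun2 s0 (vL i); have vtL := dilate_Lfun2 t0 (vL i).
  have dL := Lfun2B vsL vtL.
  have := Rintegral_sqrD_le (Lfun2Z s dL) (Lfun2Z (s - t) vtL).
  under [X in _ <= 2 * X + _ -> _]eq_Rintegral do rewrite exprMn.
  under [X in _ <= _ + 2 * X -> _]eq_Rintegral do rewrite exprMn.
  rewrite (RintegralZl _ measurableT ((Lfun2P mu _).1 dL).2).
  rewrite (RintegralZl _ measurableT ((Lfun2P mu _).1 vtL).2).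
  apply: le_trans; rewrite le_eqVlt; apply/orP; left; apply/eqP.
  by apply: eq_Rintegral => x _; rewrite /dilate; congr (_ ^+ 2); ring.
- exact: cvg_cst.
- rewrite -[X in _ --> X]addr0; apply: cvgD; last exact: dilate_cvg.
  suff h i : 2 * (s ^+ 2 * \int[mu]_x ((dilate (fun x => v x ord0 i) s x -
                         dilate (fun x => v x ord0 i) t x) ^+ 2)) +
     2 * ((s - t) ^+ 2 * \int[mu]_x (dilate (fun x => v x ord0 i) t x ^+ 2))
     @[s --> t] --> 2 * (t ^+ 2 * 0) +
     2 * ((t - t) ^+ 2 * \int[mu]_x (dilate (fun x => v x ord0 i) t x ^+ 2)).
    rewrite -[X in _ --> X](@big1_eq _ _ +%R _ (index_enum 'I_N) xpredT).
    apply: cvg_sumr => i; have := h i.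
    by rewrite subrr expr0n/= mul0r !mulr0 addr0.
  apply: cvgD; apply: cvgM; [exact: cvg_cst| |exact: cvg_cst|].
    apply: cvgM; first exact: exprn_continuous.
    exact: (dilate_cvg t0 (vL i)).
  apply: cvgM; last exact: cvg_cst.
  apply: (@cvg_comp _ _ _ (fun s => s - t) (fun y : R => y ^+ 2) _ (nbhs (t - t))).
    by apply: cvgB; [exact: cvg_id|exact: cvg_cst].
  exact: exprn_continuous.
Unshelve. all: by end_near. Qed.

(** The fundamental theorem of calculus applies to the right of [a - 1], and to
    the left of [a] the primitive is locally zero. *)
Lemma antiderivative (f : R -> R) (a : R) : continuous f ->
  (forall x, x <= a -> f x = 0) -> exists F : R -> R, forall x : R, is_derive x 1 F (f x).
Proof.
move=> cf f0; exists (fun x => \int[lebesgue_measure]_(y in `[a - 1, x]) f y) => x.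
have [xa|ax] := ltP x a.
  rewrite f0 ?ltW//; apply: (near_eq_is_derive (f := cst 0)) => //.
  near=> y; have ya : y < a by near: y; exact: lt_nbhsl.
  rewrite (@eq_Rintegral _ _ _ lebesgue_measure _ (cst 0)) ?Rintegral_cst ?mul0r//.
  move=> z; rewrite inE/= in_itv/= => /andP[_ zy].
  by rewrite f0// (le_trans zy)// ltW.
have a1x : a - 1 < x by rewrite ltrBlDr (le_lt_trans ax)// ltrDl.
have xx : x < x + 1 by rewrite ltrDl.
have [dF F'] := @continuous_FTC1_closed R f (a - 1) x (x + 1) xx
  (continuous_compact_integrable (@segment_compact _ _ _)
    (continuous_subspaceT cf)) a1x (cf x).
by apply: DeriveDef; [exact: dF|rewrite -derive1E].
Unshelve. all: by end_near. Qed.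

(** A primitive is constant on each of the two half-lines where its derivative
    vanishes, by the mean value theorem. *)
Lemma is_derive_eq0_cst (F f : R -> R) (a b x y : R) :
  (forall x : R, is_derive x 1 F (f x)) -> (forall z, ~~ (a < z < b) -> f z = 0) ->
  (x <= a /\ y <= a) \/ (b <= x /\ b <= y) -> F x = F y.
Proof.
move=> dF f0; wlog xy : x y / x <= y.
  move=> H h; have [xy|/ltW yx] := leP x y; first exact: H.
  by apply/esym/H => //; case: h => -[]; [left|right].
move=> h; have [xlty|] := boolP (x < y); last first.
  by rewrite lt_neqAle xy andbT negbK => /eqP ->.
have cF : {within `[x, y], continuous F}.
  apply: derivable_within_continuous => z _; by have [] := dF z.
have [c] := MVT xlty (fun z _ => dF z) cF.
rewrite in_itv/= => /andP[xc cy]; rewrite f0 ?mul0r.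
  by move/eqP; rewrite subr_eq0 => /eqP.
case: h => -[h1 h2]; rewrite negb_and -!leNgt.
  by rewrite (le_trans (ltW cy) h2).
by rewrite orbC (le_trans h1 (ltW xc)).
Qed.

Lemma smooth_primitive (F f : R -> R) :
  (forall x : R, is_derive x 1 F (f x)) -> smooth f -> smooth F.
Proof.
move=> dF sf; have dfF x : derivable F x 1 by have [] := dF x.
case=> [|n]; split => //; rewrite (_ : derive1 F = f)//.
by apply/funext => x; rewrite derive1E; have [] := dF x.
Qed.

(** If a partial derivative of [u] vanishes, then integration against a bump
    does not change when the bump is translated in that direction: the
    difference of the two bumps is the derivative of a test function, obtained
    by integrating in one variable. *)
Lemma bumps_translation u (i : 'I_N) a b k (T : R) : u \in L2 -> 0 < T ->
  (forall psi, test_function psi -> \int[mu]_x (u x * partial i psi x) = 0) ->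
  \int[mu]_x (u x * bumps a b k x) =
  \int[mu]_x (u x * bumps a b k (1 *: x + - T *: delta_mx ord0 i)).
Proof.
move=> uL T0 u0.
pose chi := bump (a i) (b i) k.
have schi : smooth chi by exact: smooth_bump.
have chi0 z : ~~ (a i < z < b i) -> chi z = 0 by exact: bump_out.
have [F dF] : exists F : R -> R, forall x : R, is_derive x 1 F (chi x).
  apply: (@antiderivative chi (a i)); first exact: smooth_continuous.
  by move=> x xa; rewrite chi0// negb_and -leNgt xa.
have sF := smooth_primitive dF schi.
pose eta x := F (1 * x + 0) + -1 * F (1 * x + - T).
have seta : smooth eta.
  by move=> n; apply: CkD; [exact: Ck_affine|apply: CkZ; exact: Ck_affine].
have eta' x : derive1 eta x = chi x - chi (x - T).
  have d1 : is_derive x 1 (fun x => F (1 * x + 0)) (chi x).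
    have [df e] := is_derive_affine (smooth_derivable (x := 1 * x + 0) sF).
    apply: DeriveDef => //; rewrite e mul1r mul1r addr0 derive1E.
    by have [] := dF x.
  have d2 : is_derive x 1 (fun x => F (1 * x + - T)) (chi (x - T)).
    have [df e] := is_derive_affine (smooth_derivable (x := 1 * x + - T) sF).
    apply: DeriveDef => //; rewrite e mul1r mul1r derive1E.
    by have [] := dF (x - T).
  have [_ e] := is_deriveD d1 (is_deriveZ (-1) d2).
  by rewrite derive1E [LHS]e /GRing.scale/= mulN1r.
have eta0 x : ~~ (a i < x < b i + T) -> eta x = 0.
  rewrite negb_and -!leNgt => h; rewrite /eta !mul1r addr0 mulN1r.
  apply/eqP; rewrite subr_eq0; apply/eqP.
  apply: (is_derive_eq0_cst dF chi0).
  by case/orP: h => h; [left|right]; split; lra.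
pose e j := if j == i then eta else bump (a j) (b j) k.
have se j : smooth (e j) by rewrite /e; case: ifP => _ //; exact: smooth_bump.
have te : test_function (tensor e).
  apply: (@test_function_tensor _ _ _ a (fun j => if j == i then b i + T else b j)) => //.
  move=> j x; rewrite /e; case: eqP => [->|_]; first exact: eta0.
  exact: bump_out.
have shift x j : (1 *: x + - T *: delta_mx ord0 i : E) ord0 j =
    x ord0 j - (if j == i then T else 0).
  rewrite !mxE eqxx/= mul1r; case: eqP => _; first by rewrite mulr1.
  by rewrite mulr0 subr0 addr0.
have pe x : partial i (tensor e) x =
    bumps a b k x - bumps a b k (1 *: x + - T *: delta_mx ord0 i).
  have tE (f : 'I_N -> R -> R) (y : E) : tensor f y =
      f i (y ord0 i) * \prod_(j | j != i) f j (y ord0 j) by exact: bigD1.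
  rewrite partial_tensor// /bumps !tE eqxx shift eqxx.
  rewrite {1}/e eqxx eta' mulrBl; congr (_ * _ - _ * _).
    by apply: eq_bigr => j /negbTE ji; rewrite ji /e ji.
  by apply: eq_bigr => j /negbTE ji; rewrite ji /e ji shift ji subr0.
have sL : (fun x => bumps a b k (1 *: x + - T *: delta_mx ord0 i)) \in L2.
  have [mb ib] := (Lfun2P mu _).1 (bumps_Lfun2 a b k).
  apply/Lfun2P; split; first exact: (measurableT_comp mb (measurable_affine_rV _ _)).
  exact: (integrable_affine _ ltr01 ib).
have := u0 _ te; under eq_Rintegral do rewrite pe mulrBr.
rewrite (RintegralB measurableT (Lfun2_integrableM uL (bumps_Lfun2 a b k))
  (Lfun2_integrableM uL sL)).
by move/eqP; rewrite subr_eq0 => /eqP.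
Qed.

(** A square integrable function with a vanishing partial derivative is zero:
    pushing the bump to infinity makes its integral against [u] vanish. *)
Lemma partial0_eq0 u (i : 'I_N) : u \in L2 ->
  (forall psi, test_function psi -> \int[mu]_x (u x * partial i psi x) = 0) ->
  u = cst 0 %[ae mu].
Proof.
move=> uL u0; apply: bumps_orthogonal_eq0 => // a b k.
pose A n : set E := (fun x : E => x ord0 i) @^-1` `]-oo, a i + n.+1%:R].
have mA n : measurable (A n).
  by rewrite -[A n]setTI; apply: measurable_rV_coord.
pose un n x := u x * \1_(A n) x.
have unL n : un n \in L2.
  apply: (Lfun2_le _ uL).
    by apply: measurable_funM; [exact: Lfun2_measurable uL|exact: measurable_indic].
  by move=> x; rewrite normrM ler_piMr// indicE; case: (_ \in _); rewrite ?normr1 ?normr0.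
have un_cvg : \int[mu]_x ((un n x - u x) ^+ 2) @[n --> \oo] --> (0 : R).
  apply: (Lfun2_dominated_cvg (g := fun x => `|u x|)).
  - by move=> n; exact: Lfun2_measurable (unL n).
  - exact: Lfun2_measurable uL.
  - apply: (Lfun2_le _ uL); last by move=> x; rewrite normr_id.
    by apply: measurableT_comp => //; exact: Lfun2_measurable uL.
  - move=> x; apply: cvg_near_cst.
    exists (Num.truncn `|x ord0 i - a i|) => // n /= xn.
    rewrite /un indicE mem_set ?mulr1//= /A /= in_itv/=.
    rewrite -lerBlDl; apply: le_trans (ler_norm _) _; apply: ltW.
    by apply: lt_le_trans (truncnS_gt _) _; rewrite ler_nat ltnS.
  - move=> n x; rewrite /un indicE; case: (_ \in _).
      by rewrite mulr1 subrr normr0.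
    by rewrite mulr0 sub0r normrN.
pose h n x := bumps a b k (1 *: x + - n.+1%:R *: delta_mx ord0 i).
have [mb ib] := (Lfun2P mu _).1 (bumps_Lfun2 a b k).
have hL n : h n \in L2.
  apply/Lfun2P; split; first exact: (measurableT_comp mb (measurable_affine_rV _ _)).
  exact: (integrable_affine _ ltr01 ib).
have h2 n : \int[mu]_x (h n x ^+ 2) = \int[mu]_x (bumps a b k x ^+ 2).
  have mb2 : measurable_fun setT (fun x => bumps a b k x ^+ 2).
    exact: measurable_funX.
  by rewrite [LHS](Rintegral_affine _ ltr01 mb2) expr1n invr1 mul1r.
have unh n x : un n x * h n x = 0.
  rewrite /un indicE; have [xA|xA] := boolP (x \in A n); last by rewrite mulr0 mul0r.
  rewrite /h /bumps /tensor (bigD1 i)//= !mxE !eqxx/= mulr1 mul1r bump_out ?mul0r ?mulr0//.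
  rewrite negb_and -!leNgt; apply/orP; left.
  by move: xA; rewrite inE /A/= in_itv/= mulr1 lerBlDr.
apply/eqP; rewrite -sqrf_eq0 eq_le sqr_ge0 andbT.
have lim0 : \int[mu]_x ((un n x - u x) ^+ 2) * \int[mu]_x (bumps a b k x ^+ 2)
    @[n --> \oo] --> (0 : R).
  rewrite -[X in _ --> X](mul0r (\int[mu]_x (bumps a b k x ^+ 2))).
  by apply: cvgM un_cvg _; exact: cvg_cst.
apply: (ler_cvg_to (cvg_cst _) lim0); apply: nearW => n /=.
rewrite (bumps_translation _ _ _ uL (ltr0Sn R n) u0) -(h2 n).
apply: le_trans (Rintegral_cauchy_schwarz (Lfun2B (unL n) uL) (hL n)).
under [X in _ <= X ^+ 2]eq_Rintegral do rewrite mulrBl unh sub0r.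
under [X in _ <= X ^+ 2]eq_Rintegral do rewrite -mulN1r.
rewrite RintegralZl//; first by rewrite mulN1r sqrrN.
exact: Lfun2_integrableM.
Qed.

(** One partial derivative is enough, which is where the dimension must be
    positive. *)
Lemma dirichlet_eq0 u : (0 < N)%N -> H1 u -> dirichlet u = 0 -> u = cst 0 %[ae mu].
Proof.
move=> N0 [uL [v uv]]; rewrite (dirichletE uv) => /eqP.
rewrite psumr_eq0; last by move=> i _; exact: sqr_Rintegral_ge0.
move=> /allP/(_ (Ordinal N0) (mem_index_enum _))/= /eqP v0.
have vL := uv.1 (Ordinal N0).
apply: (partial0_eq0 (i := Ordinal N0)) => // psi tp.
have L0 : (cst 0 : E -> R) \in L2.
  by have := Lfun2Z 0 uL; under eq_fun do rewrite mul0r.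
rewrite uv.2// (ae_eq_RintegralM vL L0 (test_function_Lfun2 tp)).
  by under eq_Rintegral do rewrite mul0r; rewrite Rintegral_cst// mul0r oppr0.
exact: Rintegral_sqr_eq0.
Qed.

End zero_gradient.

(** * The parameter of the branch as a function of the dilation *)

Section profile.
Context {R : realType}.
Implicit Types (c a p s t v : R).

Definition profile (alpha beta r s : R) := (alpha - beta * s ^+ 2) * s `^ r.

(** The family is stable under differentiation, so that one formula gives both
    derivatives of the branch parameter. *)
Lemma is_derive_profile (alpha beta r s : R) : 0 < s ->
  is_derive s 1 (profile alpha beta r)
    (profile (r * alpha) ((r + 2) * beta) (r - 1) s).
Proof.
move=> s0.
have d1 : is_derive s 1 (fun s : R => alpha - beta * s ^+ 2) (- (beta * (2 * s))).
  have dX : is_derive s 1 (fun s : R => s ^+ 2) (2 * s).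
    by have := is_deriveX 2 (is_derive_id s 1); rewrite expr1 /GRing.scale/= mulr1.
  have [dd e] := is_deriveB (is_derive_cst alpha s 1) (is_deriveZ beta dX).
  by apply: DeriveDef => //; rewrite e sub0r.
have [dd e] := is_deriveM d1 (is_derive1_powR r s0).
apply: DeriveDef => //; rewrite [LHS]e /GRing.scale/= /profile.
have -> : s `^ r = s * s `^ (r - 1).
  rewrite -[s in s * _]powRr1 ?ltW// -powRD; last by rewrite (gt_eqF s0) implybT.
  by rewrite addrC subrK.
by ring.
Qed.

Lemma derive1_profile (alpha beta r s : R) : 0 < s ->
  derive1 (profile alpha beta r) s = profile (r * alpha) ((r + 2) * beta) (r - 1) s.
Proof.
by move=> s0; have [_ e] := is_derive_profile alpha beta r s0; rewrite derive1E.
Qed.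

Lemma near_derive1_profile (alpha beta r s : R) : 0 < s ->
  \forall t \near s, profile (r * alpha) ((r + 2) * beta) (r - 1) t =
    derive1 (profile alpha beta r) t.
Proof.
move=> s0; near=> t; rewrite derive1_profile//.
by near: t; exact: lt_nbhsr.
Unshelve. all: by end_near. Qed.

Lemma profile_continuous (alpha beta r s t : R) : 0 < s ->
  {within `[s, t], continuous (profile alpha beta r)}.
Proof.
move=> s0; apply: derivable_within_continuous => x.
rewrite in_itv/= => /andP[sx _].
by have [] := is_derive_profile alpha beta r (lt_le_trans s0 sx).
Qed.

Lemma profile_ivt (alpha beta r s t v : R) : 0 < s -> s <= t ->
  profile alpha beta r s <= v <= profile alpha beta r t \/
  profile alpha beta r t <= v <= profile alpha beta r s ->
  exists2 x, s <= x <= t & profile alpha beta r x = v.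
Proof.
move=> s0 st h.
have [|x] := IVT st (@profile_continuous alpha beta r s t s0) (v := v).
  by rewrite ge_min le_max; case: h => /andP[-> ->]; rewrite ?orbT.
by rewrite in_itv/=; exists x.
Qed.

(** The branch parameter [c^-1 (1 - a s^2) s^p], where [c = A^theta] and
    [p = theta (N - 2) - 2]. Its derivative has the sign of [p - (p + 2) a s^2]. *)
Variables (c a p : R).
Hypotheses (c0 : 0 < c) (a0 : 0 < a) (q0 : 0 < p + 2).
Let b := profile c^-1 (a / c) p.

Lemma derive1_branchE s : 0 < s ->
  derive1 b s = c^-1 * s `^ (p - 1) * (p - (p + 2) * a * s ^+ 2).
Proof. by move=> s0; rewrite derive1_profile// /profile; ring. Qed.

Lemma is_derive2_branch s : 0 < s -> is_derive s 1 (derive1 b)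
  (c^-1 * s `^ (p - 1 - 1) * (p * (p - 1) - (p + 1) * ((p + 2) * a * s ^+ 2))).
Proof.
move=> s0; apply: (near_eq_is_derive (near_derive1_profile c^-1 (a / c) p s0)).
have [dd e] := is_derive_profile (p * c^-1) ((p + 2) * (a / c)) (p - 1) s0.
by apply: DeriveDef; [exact: dd|rewrite [LHS]e /profile; ring].
Qed.

Lemma branch_derivable s : 0 < s -> derivable b s 1.
Proof. by move=> s0; have [] := is_derive_profile c^-1 (a / c) p s0. Qed.

Lemma branch_increasing s t : 0 < s -> s < t -> (p + 2) * a * t ^+ 2 <= p ->
  b s < b t.
Proof.
move=> s0 st tp; apply: (@gtr0_derive1_incr _ b s t _ _ _ s t (lexx s) st (lexx t)).
- move=> x; rewrite in_itv/= => /andP[sx _].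
  by apply: branch_derivable; exact: lt_trans sx.
- move=> x; rewrite in_itv/= => /andP[sx xt]; have x0 := lt_trans s0 sx.
  rewrite derive1_branchE// mulr_gt0//; first by rewrite mulr_gt0 ?powR_gt0 ?invr_gt0.
  rewrite subr_gt0; apply: lt_le_trans tp.
  by rewrite ltr_pM2l ?mulr_gt0// ltrXn2r// ?nnegrE ltW// (lt_trans x0).
- exact: profile_continuous.
Qed.

Lemma branch_decreasing s t : 0 < s -> s < t -> p <= (p + 2) * a * s ^+ 2 ->
  b t < b s.
Proof.
move=> s0 st tp; apply: (@ltr0_derive1_decr _ b s t _ _ _ s t (lexx s) st (lexx t)).
- move=> x; rewrite in_itv/= => /andP[sx _].
  by apply: branch_derivable; exact: lt_trans sx.
- move=> x; rewrite in_itv/= => /andP[sx xt]; have x0 := lt_trans s0 sx.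
  rewrite derive1_branchE// pmulr_rlt0; last by rewrite mulr_gt0 ?powR_gt0 ?invr_gt0.
  rewrite subr_lt0; apply: (le_lt_trans tp).
  by rewrite ltr_pM2l ?mulr_gt0// ltrXn2r// ?nnegrE ltW.
- exact: profile_continuous.
Qed.

(** For [p > 0] the parameter is at most [c^-1 s^p]. *)
Lemma branch_small v t : 0 < p -> 0 < v -> 0 < t -> exists2 s, 0 < s < t & b s < v.
Proof.
move=> p0 v0 t0; have cv0 : 0 < c * v by rewrite mulr_gt0.
suff : \forall s \near 0^'+, 0 < s < t /\ b s < v.
  by move=> /(@filter_ex _ _ (at_right_proper_filter _))[s [? ?]]; exists s.
near=> s; have s0 : 0 < s by near: s; exact: nbhs_right_gt.
split; first by rewrite s0/=; near: s; exact: nbhs_right_lt.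
apply: (@le_lt_trans _ _ (c^-1 * s `^ p)).
  rewrite /b /profile ler_wpM2r ?powR_ge0// gerBl.
  by rewrite mulr_ge0 ?sqr_ge0// divr_ge0// ltW.
rewrite -ltr_pdivlMl ?invr_gt0// invrK.
near: s; have /cvgrPdist_lt/(_ _ cv0) := powR_cvg0 p0.
by apply: filterS => s; rewrite sub0r normrN ger0_norm// powR_ge0.
Unshelve. all: by end_near. Qed.

(** Near 0 the factor [1 - a s^2] stays above one half, so that for [p < 0] the
    power of [s] makes the parameter unbounded; for [p = 0] the parameter tends
    to [c^-1]. *)
Lemma branch_large v t : p <= 0 -> p < 0 \/ v < c^-1 -> 0 < t ->
  exists2 s, 0 < s < t & v <= b s.
Proof.
move=> p0 pv t0.
suff : \forall s \near 0^'+, 0 < s < t /\ v <= b s.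
  by move=> /(@filter_ex _ _ (at_right_proper_filter _))[s [? ?]]; exists s.
have [p_lt0|] := boolP (p < 0).
  have e0 : 0 < (2 * c * (`|v| + 1))^-1.
    by rewrite invr_gt0 !mulr_gt0// ltr_pwDr.
  have Np0 : 0 < - p by rewrite oppr_gt0.
  have a20 : 0 < (2 * a)^-1 by rewrite invr_gt0 mulr_gt0.
  near=> s; have s0 : 0 < s by near: s; exact: nbhs_right_gt.
  split; first by rewrite s0/=; near: s; exact: nbhs_right_lt.
  have s1 : s < 1 by near: s; exact: nbhs_right_lt.
  have sa : s < (2 * a)^-1 by near: s; exact: nbhs_right_lt.
  have sp : s `^ (- p) < (2 * c * (`|v| + 1))^-1.
    near: s; have /cvgrPdist_lt/(_ _ e0) := powR_cvg0 Np0.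
    by apply: filterS => s; rewrite sub0r normrN ger0_norm// powR_ge0.
  have as2 : a * s ^+ 2 <= 2^-1.
    have : s ^+ 2 <= s by rewrite expr2 ler_piMr// ltW.
    move=> /(ler_wpM2l (ltW a0))/le_trans; apply.
    have := ltW sa; rewrite invfM -ler_pdivrMr ?invr_gt0// invrK mulrC.
    by rewrite mulrC.
  have vs : 2 * c * (`|v| + 1) <= s `^ p.
    rewrite -[p]opprK powRN -[leLHS]invrK lef_pV2 ?posrE//; first exact: ltW.
    exact: powR_gt0.
  apply: (@le_trans _ _ ((2 * c)^-1 * (2 * c * (`|v| + 1)))).
    rewrite mulKf ?mulf_neq0 ?gt_eqF//.
    by rewrite (le_trans (ler_norm v))// lerDl.
  apply: ler_pM => //.
  - by rewrite invr_ge0 mulr_ge0// ltW.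
  - by rewrite !mulr_ge0// ?addr_ge0// ltW.
  - have : c^-1 * (a * s ^+ 2) <= c^-1 * 2^-1 by rewrite ler_wpM2l// invr_ge0 ltW.
    by rewrite invfM; lra.
rewrite -leNgt => p_ge0; have {p0 p_ge0} pE : p = 0 by apply/eqP; rewrite eq_le p0.
case: pv => [|v_lt]; first by rewrite pE ltxx.
have e0 : 0 < (c^-1 - v) / (a / c) by rewrite divr_gt0 ?subr_gt0// divr_gt0.
near=> s; have s0 : 0 < s by near: s; exact: nbhs_right_gt.
split; first by rewrite s0/=; near: s; exact: nbhs_right_lt.
have s1 : s < 1 by near: s; exact: nbhs_right_lt.
have sv : s < (c^-1 - v) / (a / c) by near: s; exact: nbhs_right_lt.
rewrite /b /profile pE powRr0 mulr1 lerBrDl -lerBrDr mulrC -ler_pdivlMr ?divr_gt0//.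
by rewrite (le_trans _ (ltW sv))// expr2 ler_piMr// ltW.
Unshelve. all: by end_near. Qed.

End profile.

Section diagram.
Context {R : realType} {N : nat}.
Local Notation E := 'rV[R]_N.
Local Notation mu := (@lebesgue_rV R N).
Implicit Types (I : set R) (b : R -> R) (U : R -> E -> R).

Lemma no_point_branch I b U beta : (forall s, I s -> b s <> beta) ->
  no_point (branch I b U) beta.
Proof. by move=> h u [s Is [bs _]]; exact: h bs. Qed.

Lemma one_point_branch I b U beta s : I s -> b s = beta ->
  (forall t, I t -> b t = beta -> t = s) -> one_point (branch I b U) beta.
Proof.
move=> Is bs uniq; exists (U s); first by exists s => //; rewrite bs.
by move=> w [t It [bt <-]]; rewrite (uniq t It bt); exact: aeW.
Qed.

Lemma two_points_branch I b U beta s t : I s -> I t -> b s = beta -> b t = beta ->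
  ~ U s = U t %[ae mu] ->
  (forall r, I r -> b r = beta -> r = s \/ r = t) ->
  two_points (branch I b U) beta.
Proof.
move=> Is It bs bt Ust uniq; exists (U s), (U t); split => //.
- by exists s => //; rewrite bs.
- by exists t => //; rewrite bt.
move=> w [r Ir [br <-]].
by have [->|->] := uniq r Ir br; [left|right]; exact: aeW.
Qed.

End diagram.

(** * The fold and the theorem *)

Section fold.
Context {R : realType} {N : nat}.
Local Notation E := 'rV[R]_N.
Local Notation mu := (@lebesgue_rV R N).
Variables (b : R -> R) (U : R -> E -> R) (ss sz : R).
Hypotheses (ss0 : 0 < ss) (sssz : ss < sz) (bss0 : 0 < b ss).
Hypothesis b_incr : forall s t : R, 0 < s -> s < t -> t <= ss -> b s < b t.
Hypothesis b_decr : forall s t : R, ss <= s -> s < t -> b t < b s.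
Hypothesis b_left : forall v : R, 0 < v < b ss -> exists2 s : R, 0 < s < ss & b s = v.
Hypothesis b_right : forall v : R, 0 < v < b ss -> exists2 s, ss < s < sz & b s = v.
Hypothesis U_inj : forall s t : R, 0 < s -> 0 < t -> U s = U t %[ae mu] -> s = t.
Hypothesis U_cvg : forall t : R, 0 < t ->
  H1_sqnorm (fun x => U s x - U t x) @[s --> t] --> (0 : R).

Local Notation I := [set s | 0 < s <= sz].

(** Each value below the fold is taken once on each side of it; the dilates are
    then distinct because the parameters are. *)
Lemma fold_two_points v : 0 < v < b ss -> two_points (branch I b U) v.
Proof.
move=> vb; have [s /andP[s0 s_ss] bs] := b_left vb.
have [t /andP[ss_t t_sz] bt] := b_right vb.
have t0 : 0 < t by exact: lt_trans ss_t.
apply: (two_points_branch _ _ bs bt).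
- by rewrite /= s0 ltW// (lt_trans s_ss).
- by rewrite /= t0 ltW.
- by move=> /(U_inj s0 t0) st; move: s_ss; rewrite st ltNge (ltW ss_t).
move=> r /= /andP[r0 _] br; have [rss|rss] := leP r ss.
  left; have [rs|sr|//] := ltgtP r s.
    by have := b_incr r0 rs (ltW s_ss); rewrite br bs ltxx.
  by have := b_incr s0 sr rss; rewrite br bs ltxx.
right; have [rt|tr|//] := ltgtP r t.
  by have := b_decr (ltW rss) rt; rewrite br bt ltxx.
by have := b_decr (ltW ss_t) tr; rewrite br bt ltxx.
Qed.

(** The two local inverses of [b] at the fold converge to the fold by strict
    monotonicity alone, and the dilates follow by continuity. *)
Lemma fold_coalesce : coalesce (branch I b U) (b ss)^'- (U ss).
Proof.
pose s1 v := xget ss [set s | 0 < s < ss /\ b s = v].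
pose s2 v := xget ss [set s | ss < s < sz /\ b s = v].
have s1P v : 0 < v < b ss -> 0 < s1 v < ss /\ b (s1 v) = v.
  move=> vb; have [s sI bs] := b_left vb.
  by have := @xgetPex _ ss [set s | 0 < s < ss /\ b s = v]; apply; exists s.
have s2P v : 0 < v < b ss -> ss < s2 v < sz /\ b (s2 v) = v.
  move=> vb; have [s sI bs] := b_right vb.
  by have := @xgetPex _ ss [set s | ss < s < sz /\ b s = v]; apply; exists s.
have near_b : \forall v \near (b ss)^'-, 0 < v < b ss.
  near=> v; apply/andP; split; first by near: v; exact: nbhs_left_gt.
  by near: v; exact: nbhs_left_lt.
have s1_cvg : s1 v @[v --> (b ss)^'-] --> ss.
  apply/cvgrPdist_lt => /= e e0.
  (* [ss / 2] keeps the comparison point positive when [e] is large. *)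
  pose r : R := Num.max (ss - e) (ss / 2).
  have r0 : 0 < r by rewrite lt_max divr_gt0 ?orbT.
  have rss : r < ss by rewrite gt_max gtrBl e0/= ltr_pdivrMr// ltr_pMr// ltr1n.
  have re : ss - e <= r by rewrite le_max lexx.
  near=> v; have vb : 0 < v < b ss by near: v.
  have rv : b r < v.
    by near: v; apply: nbhs_left_gt; exact: b_incr.
  have [/andP[h0 h1] h2] := s1P v vb.
  rewrite ger0_norm ?subr_ge0 ?ltW// ltrBlDr -ltrBlDl.
  apply: (le_lt_trans re); rewrite ltNge; apply/negP => h.
  have : b (s1 v) <= b r.
    by move: h; rewrite le_eqVlt => /predU1P[->//|h]; exact/ltW/b_incr/ltW.
  by rewrite h2 leNgt rv.
have s2_cvg : s2 v @[v --> (b ss)^'-] --> ss.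
  apply/cvgrPdist_lt => e e0.
  have rss : ss < ss + e by rewrite ltrDl.
  near=> v; have vb : 0 < v < b ss by near: v.
  have rv : b (ss + e) < v.
    by near: v; apply: nbhs_left_gt; exact: b_decr.
  have [/andP[h0 h1] h2] := s2P v vb.
  rewrite ler0_norm ?subr_le0 ?ltW// opprB ltrBlDl ltNge; apply/negP => h.
  have : b (s2 v) <= b (ss + e).
    by move: h; rewrite le_eqVlt => /predU1P[->//|h]; apply/ltW/b_decr => //; exact: ltW.
  by rewrite h2 leNgt rv.
exists (fun v => U (s1 v)), (fun v => U (s2 v)); split.
- apply: filterS near_b => v vb.
  have [/andP[h0 h1] h2] := s1P v vb; have [/andP[k0 k1] k2] := s2P v vb.
  have k3 : 0 < s2 v by exact: lt_trans k0.
  split.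
  + by exists (s1 v); rewrite /= ?h2// h0 ltW// (lt_trans h1).
  + by exists (s2 v); rewrite /= ?k2// k3 ltW.
  + by move=> /(U_inj h0 k3) st; move: h1; rewrite st ltNge (ltW k0).
- exact: (@cvg_comp _ _ _ s1 (fun s => H1_sqnorm (fun x => U s x - U ss x))
    _ _ _ s1_cvg (U_cvg ss0)).
- exact: (@cvg_comp _ _ _ s2 (fun s => H1_sqnorm (fun x => U s x - U ss x))
    _ _ _ s2_cvg (U_cvg ss0)).
Unshelve. all: by end_near. Qed.

End fold.

(** With [p = theta (N - 2) - 2] the powers of [s] cancel:
    [s^p s^((2 - N) theta) s^2 = 1]. *)
Lemma kirchhoff_coefficient (R : realType) (N : nat) (a theta A s : R) :
  0 < s -> 0 < A ->
  (a + branch_parameter N a theta A s * (s ^+ 2 * s ^- N * A) `^ theta) * s ^+ 2 = 1.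
Proof.
move=> s0 A0; have c0 : 0 < A `^ theta by exact: powR_gt0.
have sN : s ^+ 2 * s ^- N = s `^ (2 - N%:R).
  rewrite powRD ?(gt_eqF s0) ?implybT//.
  by rewrite powR_mulrn ?powR_invn// ltW.
rewrite sN powRM ?powR_ge0 ?ltW// -powRrM /branch_parameter.
set p := theta * _ - 2.
have e : s `^ p * s `^ ((2 - N%:R) * theta) * s ^+ 2 = 1.
  rewrite -powR_mulrn ?ltW// -!powRD ?(gt_eqF s0) ?implybT//.
  have -> : p + (2 - N%:R) * theta + 2 = 0 by rewrite /p; ring.
  by rewrite powRr0.
move: e; set x := s `^ p; set y := s `^ ((2 - N%:R) * theta) => e.
transitivity (a * s ^+ 2 + (1 - a * s ^+ 2) * (x * y * s ^+ 2)).
  by field; rewrite gt_eqF.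
by rewrite e mulr1 addrCA subrr addr0.
Qed.

Theorem theorem4p4 (R : realType) (N : nat) (a theta m : R) (g : R -> R)
    (phi : 'rV[R]_N -> R) :
  (3 <= N)%N -> 0 < a -> 0 < theta ->
  0 < m -> berestycki_lions N m g ->
  DG g phi -> weak_solution 1 g phi ->
  (N%:R - 2) / 2 * dirichlet phi = N%:R * potential g phi ->
  let A := dirichlet phi in
  let sz := a `^ (- (1 / 2)) in
  let I := [set s | 0 < s <= sz] in
  let b := branch_parameter N a theta A in
  let U := dilate phi in
  let Gamma := branch I b U in
  let q := theta * (N%:R - 2) in
  let ss := ((q - 2) / (a * q)) `^ (1 / 2) in
  let bs := 2 / (q * A `^ theta) * ((q - 2) / (a * q)) `^ ((q - 2) / 2) in
  [/\ forall beta u, Gamma (beta, u) -> kirchhoff_solution a theta g beta u,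
      2 < q ->
        [/\ turning_point I b U ss /\ b ss = bs,
            forall s, turning_point I b U s -> s = ss,
            forall beta, 0 < beta < bs -> two_points Gamma beta,
            one_point Gamma 0 /\ one_point Gamma bs &
            forall beta, bs < beta -> no_point Gamma beta],
      q = 2 ->
        (forall beta, 0 <= beta < A `^ (- theta) -> one_point Gamma beta) /\
        (forall beta, A `^ (- theta) <= beta -> no_point Gamma beta),
      q < 2 -> forall beta, 0 <= beta -> one_point Gamma beta &
      (exists2 s, 0 < s < sz & turning_point I b U s) <-> 2 < q].
Proof.
move=> N3 a0 th0 m0 [cg _ _ _ _] Dphi wphi _ A sz I b U Gamma q ss bs.
have [H1phi phi0 _] := Dphi; have [phiL _] := H1phi.
have N0 : (0 < N)%N by exact: leq_trans N3.
have N2 : 0 < N%:R - 2 :> R by rewrite subr_gt0 ltr_nat.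
have A0 : 0 < A.
  rewrite lt_neqAle dirichlet_ge0 andbT eq_sym; apply/eqP => A0.
  by apply: phi0; exact: dirichlet_eq0.
set c := A `^ theta in bs *; have c0 : 0 < c by exact: powR_gt0.
have q0 : 0 < q by rewrite mulr_gt0.
pose p := q - 2; have pq : p + 2 = q by rewrite subrK.
have p20 : 0 < p + 2 by rewrite pq.
have bE : b = profile c^-1 (a / c) p.
  by apply/funext => s; rewrite /b /branch_parameter /profile -/c -/q -/p; ring.
have sz0 : 0 < sz by exact: powR_gt0.
have sz2 : a * sz ^+ 2 = 1.
  rewrite -powR_mulrn ?ltW// -powRrM mulNr div1r mulVf// powR_inv1 ?ltW//.
  by rewrite divff// gt_eqF.
have bsE s : b s = c^-1 * (1 - a * s ^+ 2) * s `^ p.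
  by rewrite bE /profile; ring.
have b_sz : b sz = 0 by rewrite bsE sz2 subrr mulr0 mul0r.
have as_lt s : 0 < s -> s < sz -> a * s ^+ 2 < 1.
  by move=> s0 ssz; rewrite -sz2 ltr_pM2l// ltrXn2r// ?nnegrE ?ltW.
have b_gt0 s : 0 < s -> s < sz -> 0 < b s.
  move=> s0 ssz; rewrite bsE !mulr_gt0 ?invr_gt0 ?powR_gt0// subr_gt0.
  exact: as_lt.
have b_ge0 s : I s -> 0 <= b s.
  by move=> /andP[s0]; rewrite le_eqVlt => /predU1P[->|/(b_gt0 s s0)/ltW//]; rewrite b_sz.
have Isz : I sz by rewrite /I/= sz0 lexx.
have U_inj s t : 0 < s -> 0 < t -> U s = U t %[ae lebesgue_rV N] -> s = t.
  by move=> s0 t0; exact: (dilate_inj N0 s0 t0 phiL phi0).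
have U_cvg t : 0 < t -> H1_sqnorm (fun x => U s x - U t x) @[s --> t] --> (0 : R).
  by move=> t0; exact: H1_sqnorm_dilate_cvg.
(* A critical point satisfies [p = q a s^2]: this yields uniqueness of the
   turning point, and [q > 2] when there is one. *)
have crit s : 0 < s -> derive1 b s = 0 -> p = q * a * s ^+ 2.
  move=> s0; rewrite bE derive1_branchE// => /eqP; rewrite mulf_eq0 gt_eqF/=.
    by rewrite subr_eq0 pq => /eqP.
  by rewrite mulr_gt0 ?invr_gt0 ?powR_gt0.
have crit_gt2 s : 0 < s -> derive1 b s = 0 -> 2 < q.
  move=> s0 /(crit s s0) ps; rewrite -subr_gt0 -/p ps.
  by rewrite !mulr_gt0// exprn_gt0.
have decr s t : p <= 0 -> 0 < s -> s < t -> b t < b s.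
  move=> p0 s0 st; rewrite bE; apply: (branch_decreasing c0 a0 p20 s0 st).
  by rewrite (le_trans p0)// !mulr_ge0 ?sqr_ge0// ltW.
have unique s t : p <= 0 -> 0 < s -> 0 < t -> b s = b t -> s = t.
  move=> p0 s0 t0 st; have [h|h|//] := ltgtP s t.
    by have := decr _ _ p0 s0 h; rewrite st ltxx.
  by have := decr _ _ p0 t0 h; rewrite st ltxx.
have one_le2 v : p <= 0 -> p < 0 \/ v < c^-1 -> 0 <= v -> one_point Gamma v.
  move=> p0 pv v0; have [s /andP[s0 s_sz] vs] := branch_large c0 a0 p0 pv sz0.
  have [|r /andP[sr rsz] br] := @profile_ivt _ c^-1 (a / c) p s sz v s0 (ltW s_sz).
    by right; rewrite -bE b_sz v0/= bE.
  have r0 : 0 < r by exact: lt_le_trans sr.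
  apply: (@one_point_branch _ _ I b U v r); [by rewrite /I/= r0|by rewrite bE|].
  by move=> t /andP[t0 _]; rewrite -br -bE; exact: unique.
have b_turn : 2 < q ->
  [/\ 0 < p, 0 < ss < sz, q * a * ss ^+ 2 = p & b ss = bs].
  move=> q2; have p0 : 0 < p by rewrite subr_gt0.
  have x0 : 0 < p / (a * q) by rewrite divr_gt0// mulr_gt0.
  have ss0 : 0 < ss by exact: powR_gt0.
  have ss2 : ss ^+ 2 = p / (a * q).
    by rewrite -powR_mulrn ?ltW// -powRrM div1r mulVf// powRr1// ltW.
  have qss : q * a * ss ^+ 2 = p.
    by rewrite ss2; field; rewrite !gt_eqF.
  split => //.
    rewrite ss0/= -(@ltr_pXn2r _ 2)// ?nnegrE ?ltW//.
    rewrite -(ltr_pM2l a0) sz2 ss2 -(ltr_pM2l q0) mulr1.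
    rewrite (_ : q * _ = p); first by rewrite /p ltrBlDr ltrDl.
    by field; rewrite !gt_eqF.
  rewrite bsE ss2 /bs -/c -powRrM -/p mulrC div1r [2^-1 * p]mulrC.
  rewrite mulrC; congr (_ * _); rewrite /p; field.
  by rewrite !gt_eqF.
have gt2 : 2 < q ->
    [/\ turning_point I b U ss /\ b ss = bs,
        forall s, turning_point I b U s -> s = ss,
        forall beta, 0 < beta < bs -> two_points Gamma beta,
        one_point Gamma 0 /\ one_point Gamma bs &
        forall beta, bs < beta -> no_point Gamma beta].
  move=> q2; have [p0 /andP[ss0 sssz] qss bss] := b_turn q2.
  have incr s t : 0 < s -> s < t -> t <= ss -> b s < b t.
    move=> s0 st tss; rewrite bE; apply: (branch_increasing c0 a0 p20 s0 st).
    rewrite pq -qss ler_pM2l ?mulr_gt0// lerXn2r// ?nnegrE ltW//.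
    exact: lt_trans st.
  have decr' s t : ss <= s -> s < t -> b t < b s.
    move=> sss st; have s0 : 0 < s by exact: lt_le_trans sss.
    rewrite bE; apply: (branch_decreasing c0 a0 p20 s0 st).
    by rewrite pq -qss ler_pM2l ?mulr_gt0// lerXn2r// nnegrE ltW.
  have bss0 : 0 < b ss by exact: b_gt0.
  have left v : 0 < v < b ss -> exists2 s : R, 0 < s < ss & b s = v.
    move=> /andP[v0 vb]; have [s /andP[s0 s_ss] bv] := branch_small c0 a0 p0 v0 ss0.
    have [|r /andP[sr rss] br] := @profile_ivt _ c^-1 (a / c) p s ss v s0 (ltW s_ss).
      by left; rewrite (ltW bv) -bE ltW.
    exists r; last by rewrite bE.
    rewrite (lt_le_trans s0 sr)/= lt_neqAle rss andbT; apply/eqP => rE.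
    by move: vb; rewrite -br -bE rE ltxx.
  have right v : 0 < v < b ss -> exists2 s, ss < s < sz & b s = v.
    move=> /andP[v0 vb].
    have [|r /andP[sr rss] br] := @profile_ivt _ c^-1 (a / c) p ss sz v ss0 (ltW sssz).
      by right; rewrite -bE b_sz (ltW v0) ltW.
    exists r; last by rewrite bE.
    rewrite !lt_neqAle sr rss !andbT; apply/andP; split; apply/eqP => rE.
      by move: vb; rewrite -br -bE rE ltxx.
    by move: v0; rewrite -br -bE rE b_sz ltxx.
  have max_ss s : 0 < s -> s != ss -> b s < b ss.
    move=> s0; rewrite neq_lt => /orP[h|h]; first exact: incr.
    exact: decr'.
  have d1 : derive1 b ss = 0.
    by rewrite bE derive1_branchE// pq qss subrr mulr0.
  have [dd e2] := is_derive2_branch c a p ss0; rewrite -bE in dd e2.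
  have d2 : derive1n 2 b ss < 0.
    rewrite derive1nS derive1n1 derive1E e2 pq qss.
    rewrite (_ : p * (p - 1) - (p + 1) * p = - (2 * p)); last by ring.
    by rewrite mulrN oppr_lt0 !mulr_gt0 ?invr_gt0// powR_gt0.
  rewrite -bss; split.
  + split => //; split => //.
    * by rewrite /I/= ss0 ltW.
    * split => //; near=> t; rewrite bE; apply: branch_derivable.
      by near: t; exact: lt_nbhsr.
    * by split => //; rewrite lt_eqF.
    * by move=> _; exact: (fold_coalesce (sz := sz)).
    * by move=> h; have := lt_trans h d2; rewrite ltxx.
  + move=> s [/andP[s0 _] [_ /(crit s s0) ps] _ _ _].
    apply/eqP; rewrite -(@eqrXn2 _ 2)//; [|exact: ltW..]; apply/eqP.
    by apply: (mulfI (_ : q * a != 0)); rewrite ?qss// mulf_neq0// gt_eqF.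
  + by move=> v; exact: fold_two_points.
  + split.
      apply: (@one_point_branch _ _ I b U 0 sz) => // t /andP[t0].
      by rewrite le_eqVlt => /predU1P[//|/(b_gt0 t t0)] h h0; rewrite h0 ltxx in h.
    apply: (@one_point_branch _ _ I b U (b ss) ss) => //.
      by rewrite /I/= ss0 ltW.
    move=> t /andP[t0 _] bt; apply/eqP; apply/negPn/negP => /(max_ss t t0).
    by rewrite bt ltxx.
  + move=> v vb; apply: no_point_branch => s /andP[s0 _] bv.
    have [sE|/(max_ss s s0)] := eqVneq s ss; first by move: vb; rewrite -bv sE ltxx.
    by rewrite bv ltNge (ltW vb).
split.
- move=> beta u [s Is [<- <-]]; have /andP[s0 _] := Is; split.
  + exact: b_ge0.
  + exact: DG_dilate.
  + apply: weak_solution_dilate => //.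
    by rewrite dirichlet_dilate// -/A; exact: kirchhoff_coefficient.
- exact: gt2.
- move=> q2; have p0 : p = 0 by rewrite /p q2 subrr.
  have cE : A `^ (- theta) = c^-1 by rewrite powRN.
  rewrite cE; split=> v.
    by move=> /andP[v0 vc]; apply: one_le2 => //; [rewrite p0|right].
  move=> cv; apply: no_point_branch => s /andP[s0 _] bv.
  move: cv; rewrite -bv bsE p0 powRr0 mulr1 leNgt => /negP; apply.
  rewrite -[ltRHS]mulr1 ltr_pM2l ?invr_gt0// gtrBl.
  by rewrite mulr_gt0// exprn_gt0.
- move=> q2 v v0; have p_lt0 : p < 0 by rewrite subr_lt0.
  by apply: one_le2 => //; [exact: ltW|left].
- split=> [[s /andP[s0 _] [_ [_ d0] _ _ _]]|q2]; first exact: crit_gt2 d0.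
  have [_ ssz _ _] := b_turn q2; have [[tss _] _ _ _ _] := gt2 q2.
  by exists ss.
Unshelve. all: by end_near. Qed.
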